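(* Let $(M^n,g,S,t)$ be a simply connected abundant manifold, $n\ge2$. Then its associated relative affine hypersurface normalisation is an affine graph normalisation if and only if: - for $n\ge3$: the trace-free part $\mathring{\mathsf P}^g$ of the Schouten tensor and the scalar curvature of $g$ satisfy $$\mathring{\mathsf P}^g=\tfrac18\tau,\qquad \mathrm{Scal}^g=\tfrac19\big(|S|_g^2-(n-1)(n+2)|\mathrm{grad}_gt|_g^2\big);$$ - for $n=2$: $$\mathrm{Scal}^g=\tfrac19\big(|S|_g^2-4|\mathrm{grad}_gt|_g^2\big),\qquad \tau=\tfrac23E-\tfrac89\Big(S(\mathrm{grad}_gt)+dt\otimes dt-\tfrac12|\mathrm{grad}_gt|_g^2\,g\Big).$$
   Context: All manifolds are smooth, connected and oriented. A hat denotes raising the last index by the metric; $|\cdot|$ is the full-contraction norm; $\mathrm{div}$ contracts the covariant derivative with one argument; $\circ$ (ring or subscript) denotes the trace-free part; $S(\mathrm{grad}_gt)=S(\cdot,\cdot,\mathrm{grad}_gt)$, etc.; $\Pi_{\mathrm{Sym}^k}$, $\Pi_{\mathrm{Sym}^k_0}$ are projections onto totally symmetric, respectively totally symmetric trace-free tensors. **Hypersurfaces.** Let $\bar\nabla$ be the standard flat connection on $\mathbb{R}^{n+1}$. An affine hypersurface normalisation $(f,\xi)$ is an immersion $f:M^n\to\mathbb{R}^{n+1}$ with a transversal field $\xi$. Suppressing $f$, one decomposes $\bar\nabla_XY=\nabla_XY+G(X,Y)\xi$, $\bar\nabla_X\xi=-\hat A(X)+\Theta(X)\xi$. It is non-degenerate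 if $G$ is non-degenerate (always assumed) and relative if $\Theta=0$. $G$ is the associated metric, and $C(X,Y,Z)=G(\nabla_XY-\nabla^G_XY,Z)$ the associated cubic. A relative normalisation is a graph normalisation if there is a smooth function $F:M\to\mathbb{R}$ such that $\bar\nabla_XY=\nabla_XY+(\nabla^2F)(X,Y)\xi$ and $\bar\nabla_X\xi=0$ for all $X,Y$. **Associated normalisation.** For a simply connected abundant manifold $(M,g,S,t)$, the associated relative hypersurface normalisation is the one (unique up to affine transformations of $\mathbb{R}^{n+1}$) with metric $G=g$ and cubic $C(X,Y,Z)=\frac13\big(S(X,Y,Z)+dt(X)g(Y,Z)+dt(Y)g(X,Z)+dt(Z)g(X,Y)\big)$. **Abundant manifold, $n\ge3$.** $(M,g,S,t)$ with $(M,g)$ conformally flat (pseudo-)Riemannian of dimension $n$, $S$ a totally symmetric trace-free $(0,3)$-tensor field, $t$ a smooth function. Define $g(S_XY,Z)=S(X,Y,Z)$, $\hat S(X,Y)=S_XY$, $\mathscr S(X,Y)=\mathrm{tr}(S_XS_Y)$, $|S|_g^2=\mathrm{tr}_g\mathscr S$, and the Schouten tensor $\mathsf P^g=\frac1{n-2}\big(\mathrm{Ric}^g-\frac{\mathrm{Scal}^g}{2(n-1)}g\big)$. Conditions: (i) $(\nabla^g)^2t=3\mathsf P^g+\frac13\big(dt\otimes dt-\frac12|\mathrm{grad}\,t|_g^2g\big)+\frac1{3(n-2)}\Big(\mathscr S+\frac{(n-6)|S|_g^2}{2(n-1)(n+2)}g\Big)$; (ii) $(\nabla^g_WS)(X,Y,Z)=\frac13(\Pi_{\mathrm{Sym}^3_0}S_1)(X,Y,Z,W)$,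 where $S_1(X,Y,Z,W)=g(S_XS_YZ,W)+3S(X,Y,W)dt(Z)+S(X,Y,Z)dt(W)+\big(\frac4{n-2}\mathscr S(Y,Z)-3S(Y,Z,\mathrm{grad}_gt)\big)g(X,W)$, with $\Pi_{\mathrm{Sym}^3_0}$ acting on the first three arguments; (iii) the algebraic curvature tensor $\frac12\big(g(S_XZ,S_YW)-g(S_XW,S_YZ)\big)$ in $(X,Y,Z,W)$ has vanishing totally trace-free (Weyl) part. For $n\ge3$, $\tau$ is the tensor $\tau=\frac2{3(n-2)}\mathring{\mathscr S}-\frac23\big[dt(\hat S(\cdot,\cdot))+dt\otimes dt\big]_\circ+2\mathring{\mathsf P}^g$. **Abundant manifold, $n=2$.** $(M,g,S,t)$ with $(M,g)$ a 2-dimensional (pseudo-)Riemannian manifold, $S$ totally symmetric trace-free $(0,3)$, $t$ smooth. Put $E:=\mathrm{div}_g(S)+\frac23S(\mathrm{grad}_gt)$, $\tau:=\frac23(\nabla^g)^2t-\frac23S(\mathrm{grad}_gt)+\frac13E-\frac89\big(dt\otimes dt-\frac12|dt|^2g\big)-\frac19|S|^2g-\frac12\mathrm{Scal}^g\,g$, $\beta(X)=\mathrm{tr}_g\big(S(X,\cdot,\hat E(\cdot))\big)$, $\eta(X)=\mathrm{tr}_g\big(S(X,\cdot,\hat\tau(\cdot))\big)$. Conditions: $\tau$ is trace-free, and (a) $(\nabla^g_WS)(X,Y,Z)=\Pi_{\mathrm{Sym}^3_0}\big[-\frac23S\otimes dt+2\,dt\otimes S+E\otimes g\big](X,Y,Z,W)$,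 with $\Pi_{\mathrm{Sym}^3_0}$ acting on the first three arguments; (b) $(\nabla^g_ZE)(X,Y)=\frac13|S|^2S(X,Y,Z)+\frac43\Pi_{\mathrm{Sym}^2}\big(\beta\otimes g(\cdot,Z)-\frac12\beta(Z)g\big)(X,Y)+\frac43\Pi_{\mathrm{Sym}^3}\big(E\otimes dt-\frac12g\otimes E(\mathrm{grad}_gt)\big)(X,Y,Z)$; (c) $\mathrm{div}_g(\tau)=-\eta+\beta-\frac23E(\mathrm{grad}_gt)-\frac49S(\mathrm{grad}_gt,\mathrm{grad}_gt)-\frac59|S|^2dt+\frac12d\,\mathrm{Scal}^g-\mathrm{Scal}^g\,dt$. *)

(* Defs.v *)
From HB Require Import structures.
From mathcomp Require Import all_boot all_order all_algebra.
From mathcomp Require Import all_classical all_reals all_analysis.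

Set Implicit Arguments.
Unset Strict Implicit.
Unset Printing Implicit Defensive.

Import Order.TTheory GRing.Theory Num.Theory.
Import numFieldNormedType.Exports.

Local Open Scope classical_set_scope.
Local Open Scope ring_scope.

Section Smoothness.
Context {R : realType} {n : nat} {V : normedModType R}.
Implicit Types (U : set 'rV[R]_n) (f : 'rV[R]_n -> V).

Definition pder (i : 'I_n) f (x : 'rV[R]_n) : V := 'D_(delta_mx 0 i) f x.

Fixpoint Ck_on (k : nat) U f : Prop :=
  if k is k'.+1 then
    (forall x, U x -> differentiable f x) /\ (forall i, Ck_on k' U (pder i f))
  else forall x, U x -> {for x, continuous f}.

(* Meant for an open U: only the values of f near points of U matter. *)
Definition smooth_on U f : Prop := forall k, Ck_on k U f.

End Smoothness.

Definition simply_connected (R : realType) (T : topologicalType) : Prop :=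
  (forall p q : T, exists c : R -> T,
     {within `[0, 1], continuous c} /\ (c 0 = p /\ c 1 = q)) /\
  (forall c : R -> T, {within `[0, 1], continuous c} -> c 0 = c 1 ->
     exists H : R * R -> T,
       {within `[0, 1] `*` `[0, 1], continuous H} /\
       forall s, `[0, 1]%classic s ->
         [/\ H (0, s) = c s, H (1, s) = c 0, H (s, 0) = c 0 & H (s, 1) = c 0]).

(* cmap and cinv are total functions; only their restrictions to cdom and to
   cmap @` cdom are meaningful. *)
Record chart (R : realType) (n : nat) (M : topologicalType) := Chart {
  cdom : set M;
  cmap : M -> 'rV[R]_n;
  cinv : 'rV[R]_n -> M;
  cdom_open : open cdom;
  cimg_open : open (cmap @` cdom);
  cmapK : forall p, cdom p -> cinv (cmap p) = p;
  cmap_continuous : forall p, cdom p -> {for p, continuous cmap};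
  cinv_continuous : forall x, (cmap @` cdom) x -> {for x, continuous cinv}
}.

Definition transition (R : realType) (n : nat) (M : topologicalType)
  (a b : chart R n M) : 'rV[R]_n -> 'rV[R]_n := cmap b \o cinv a.

Definition overlap (R : realType) (n : nat) (M : topologicalType)
  (a b : chart R n M) : set 'rV[R]_n := cmap a @` (cdom a `&` cdom b).

(* A connected smooth n-manifold; the orientation is carried by the atlas,
   whose transition maps all have positive Jacobian determinant. *)
Record manifold (R : realType) (n : nat) := Manifold {
  carrier :> topologicalType;
  mfd_hausdorff : hausdorff_space carrier;
  mfd_second_countable : @second_countable carrier;
  mfd_connected : connected [set: carrier];
  atlas_index : Type;
  atlas : atlas_index -> chart R n carrier;
  atlas_cover : forall p, exists a, cdom (atlas a) p;
  atlas_smooth : forall a b,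
    smooth_on (overlap (atlas a) (atlas b)) (transition (atlas a) (atlas b));
  atlas_oriented : forall a b x, overlap (atlas a) (atlas b) x ->
    0 < \det (jacobian (transition (atlas a) (atlas b)) x)
}.

(* Tensor calculus in the coordinates of a chart. The components of a covariant
   tensor field are functions of the coordinate point x (last argument).  *)
Section LocalTensors.
Context {R : realType} {n : nat}.
Local Notation E := 'rV[R]_n.
Local Notation scalar := (E -> R).
Local Notation tens1 := ('I_n -> E -> R).
Local Notation tens2 := ('I_n -> 'I_n -> E -> R).
Local Notation tens3 := ('I_n -> 'I_n -> 'I_n -> E -> R).
Local Notation tens4 := ('I_n -> 'I_n -> 'I_n -> 'I_n -> E -> R).

(* Connection coefficients, contravariant index first:
   nabla_(d_i) d_j = \sum_k (Gam k i j) d_k. *)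
Implicit Types (Gam : tens3).

(* (cov_m Gam T) w i ... = (nabla_(d_w) T)(d_i, ...). *)
Definition cov1 Gam (a : tens1) : tens2 := fun w i x =>
  pder w (a i) x - \sum_k Gam k w i x * a k x.

Definition cov2 Gam (b : tens2) : tens3 := fun w i j x =>
  pder w (b i j) x - \sum_k Gam k w i x * b k j x - \sum_k Gam k w j x * b i k x.

Definition cov3 Gam (T : tens3) : tens4 := fun w i j k x =>
  pder w (T i j k) x - \sum_l Gam l w i x * T l j k x
  - \sum_l Gam l w j x * T i l k x - \sum_l Gam l w k x * T i j l x.

Definition dfun (u : scalar) : tens1 := fun i => pder i u.

Definition hess Gam (u : scalar) : tens2 := cov1 Gam (dfun u).

(* R(d_i, d_j) d_k = \sum_l (riem Gam l k i j) d_l, with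
   R(X,Y) = [nabla_X, nabla_Y] - nabla_[X,Y]. *)
Definition riem Gam : tens4 := fun l k i j x =>
  pder i (Gam l j k) x - pder j (Gam l i k) x
  + \sum_m (Gam l i m x * Gam m j k x - Gam l j m x * Gam m i k x).

(* Ric(Y,Z) = tr (X |-> R(X,Y)Z), positive on round spheres. *)
Definition ricci Gam : tens2 := fun j k x => \sum_i riem Gam i k i j x.

Definition sym2 (b : tens2) : tens2 := fun i j x => 2^-1 * (b i j x + b j i x).

Definition sym3 (T : tens3) : tens3 := fun i j k x =>
  6^-1 * (T i j k x + T i k j x + T j i k x + T j k i x + T k i j x + T k j i x).

Variable g : tens2.

Definition metric_mx (x : E) : 'M[R]_n := \matrix_(i, j) g i j x.

Definition ginv : tens2 := fun i j x => invmx (metric_mx x) i j.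

(* Christoffel symbols of the Levi-Civita connection of g. *)
Definition levi_civita : tens3 := fun k i j x =>
  2^-1 * \sum_l ginv k l x *
    (pder i (g j l) x + pder j (g i l) x - pder l (g i j) x).

Definition trg (b : tens2) : scalar := fun x =>
  \sum_i \sum_j ginv i j x * b i j x.

Definition tracefree (b : tens2) : tens2 := fun i j x =>
  b i j x - n%:R^-1 * trg b x * g i j x.

Definition Ric : tens2 := ricci levi_civita.
Definition Scal : scalar := trg Ric.

Definition schouten : tens2 := fun i j x =>
  (n%:R - 2)^-1 * (Ric i j x - Scal x / (2 * (n%:R - 1)) * g i j x).

(* g-orthogonal projection of T onto totally symmetric trace-free tensors. *)
Definition sym3_0 (T : tens3) : tens3 := fun i j k x =>
  let theta l := trg (fun a b => sym3 T a b l) x in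
  sym3 T i j k x
  - (n%:R + 2)^-1 * (g i j x * theta k + g i k x * theta j + g j k x * theta i).

Definition grad (u : scalar) : tens1 := fun k x =>
  \sum_l ginv k l x * pder l u x.

Definition norm2_grad (u : scalar) : scalar := fun x =>
  \sum_i \sum_j ginv i j x * pder i u x * pder j u x.

Definition hat2 (b : tens2) : tens2 := fun k i x =>
  \sum_l ginv k l x * b i l x.

(* S_(d_i) d_j = \sum_k (hat3 S k i j) d_k. *)
Definition hat3 (S : tens3) : tens3 := fun k i j x =>
  \sum_l ginv k l x * S i j l x.

Definition div2 (b : tens2) : tens1 := fun i x =>
  \sum_k \sum_l ginv k l x * cov2 levi_civita b k l i x.

Definition div3 (S : tens3) : tens2 := fun i j x =>
  \sum_k \sum_l ginv k l x * cov3 levi_civita S k l i j x.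

Definition contr1 (b : tens2) (v : tens1) : tens1 := fun i x =>
  \sum_k b i k x * v k x.

Definition contr2 (S : tens3) (v : tens1) : tens2 := fun i j x =>
  \sum_k S i j k x * v k x.

(* X |-> tr_g (S(X, . , bhat(.))) *)
Definition trace_hat (S : tens3) (b : tens2) : tens1 := fun i =>
  trg (fun a c x => \sum_k S i a k x * hat2 b k c x).

Definition scrS (S : tens3) : tens2 := fun i j x =>
  \sum_a \sum_b hat3 S a i b x * hat3 S b j a x.

Definition norm2S (S : tens3) : scalar := trg (scrS S).

(* Weyl part of an algebraic curvature tensor K, normalised so that its Ricci
   contraction is over the first and third arguments. *)
Definition ricci_contr (K : tens4) : tens2 := fun j l =>
  trg (fun i k => K i j k l).

Definition weyl_part (K : tens4) : tens4 := fun i j k l x =>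
  let P a b := (n%:R - 2)^-1 * (ricci_contr K a b x
       - trg (ricci_contr K) x / (2 * (n%:R - 1)) * g a b x) in
  K i j k l x - (P i k * g j l x + P j l * g i k x
                 - P i l * g j k x - P j k * g i l x).

Section Abundance.
Variables (S : tens3) (t : scalar).

Definition dtdt : tens2 := fun i j x => dfun t i x * dfun t j x.

Section DimGe3.

Definition hess_eq_ge3 (x : E) : Prop := forall i j,
  hess levi_civita t i j x =
    3 * schouten i j x
    + 3^-1 * (dtdt i j x - 2^-1 * norm2_grad t x * g i j x)
    + (3 * (n%:R - 2))^-1 *
      (scrS S i j x + (n%:R - 6) * norm2S S x
                      / (2 * (n%:R - 1) * (n%:R + 2)) * g i j x).

(* The first term is g(S_X S_Y Z, W) = S(X, S_Y Z, W). *)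
Definition S1_ge3 : tens4 := fun i j k w x =>
  (\sum_l S i l w x * hat3 S l j k x)
  + 3 * S i j w x * dfun t k x + S i j k x * dfun t w x
  + (4 / (n%:R - 2) * scrS S j k x - 3 * contr2 S (grad t) j k x) * g i w x.

Definition cov_eq_ge3 (x : E) : Prop := forall w i j k,
  cov3 levi_civita S w i j k x
  = 3^-1 * sym3_0 (fun a b c => S1_ge3 a b c w) i j k x.

Definition curvS : tens4 := fun i j k l x =>
  2^-1 * \sum_a \sum_b g a b x *
    (hat3 S a i k x * hat3 S b j l x - hat3 S a i l x * hat3 S b j k x).

Definition weyl_eq_ge3 (x : E) : Prop := forall i j k l,
  weyl_part curvS i j k l x = 0.

Definition tau_ge3 : tens2 := fun i j x =>
  2 / (3 * (n%:R - 2)) * tracefree (scrS S) i j x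
  - 2 / 3 * tracefree (fun a b y =>
      (\sum_k dfun t k y * hat3 S k a b y) + dtdt a b y) i j x
  + 2 * tracefree schouten i j x.

End DimGe3.

Section Dim2.

Definition E2 : tens2 := fun i j x =>
  div3 S i j x + 2 / 3 * contr2 S (grad t) i j x.

Definition tau2 : tens2 := fun i j x =>
  2 / 3 * hess levi_civita t i j x
  - 2 / 3 * contr2 S (grad t) i j x
  + 3^-1 * E2 i j x
  - 8 / 9 * (dtdt i j x - 2^-1 * norm2_grad t x * g i j x)
  - 9^-1 * norm2S S x * g i j x
  - 2^-1 * Scal x * g i j x.

Definition beta2 : tens1 := trace_hat S E2.
Definition eta2 : tens1 := trace_hat S tau2.

Definition tau2_tracefree (x : E) : Prop := trg tau2 x = 0.

Definition cov_eq_2 (x : E) : Prop := forall w i j k,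
  cov3 levi_civita S w i j k x =
  sym3_0 (fun a b c y =>
    - (2 / 3) * (S a b c y * dfun t w y) + 2 * (dfun t a y * S b c w y)
    + E2 a b y * g c w y) i j k x.

Definition covE_eq_2 (x : E) : Prop := forall k i j,
  cov2 levi_civita E2 k i j x =
  3^-1 * norm2S S x * S i j k x
  + 4 / 3 * sym2 (fun a b y =>
      beta2 a y * g b k y - 2^-1 * beta2 k y * g a b y) i j x
  + 4 / 3 * sym3 (fun a b c y =>
      E2 a b y * dfun t c y - 2^-1 * g a b y * contr1 E2 (grad t) c y) i j k x.

Definition divtau_eq_2 (x : E) : Prop := forall i,
  div2 tau2 i x =
  - eta2 i x + beta2 i x - 2 / 3 * contr1 E2 (grad t) i x
  - 4 / 9 * contr1 (contr2 S (grad t)) (grad t) i x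
  - 5 / 9 * norm2S S x * dfun t i x
  + 2^-1 * dfun Scal i x - Scal x * dfun t i x.

End Dim2.
End Abundance.
End LocalTensors.

Section OnManifold.
Context {R : realType} {n : nat} (M : manifold R n).
Implicit Types (a b : atlas_index M).

Definition chart_image a : set 'rV[R]_n := cmap (atlas a) @` cdom (atlas a).

Definition in_chart {V : Type} a (f : M -> V) : 'rV[R]_n -> V :=
  f \o cinv (atlas a).

Definition smooth_map {V : normedModType R} (f : M -> V) : Prop :=
  forall a, smooth_on (chart_image a) (in_chart a f).

(* Components of covariant tensor fields in every chart of the atlas, subject to
   smoothness and the change-of-coordinates law. The row i of the Jacobian
   matrix holds the components of the i-th partial derivative. *)
Definition tfield2 := atlas_index M -> 'I_n -> 'I_n -> 'rV[R]_n -> R.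
Definition tfield3 := atlas_index M -> 'I_n -> 'I_n -> 'I_n -> 'rV[R]_n -> R.

Definition is_tensor2 (T : tfield2) : Prop :=
  (forall a i j, smooth_on (chart_image a) (T a i j)) /\
  (forall a b x, overlap (atlas a) (atlas b) x ->
     let phi := transition (atlas a) (atlas b) in
     forall i j, T a i j x =
       \sum_k \sum_l jacobian phi x i k * jacobian phi x j l
                     * T b k l (phi x)).

Definition is_tensor3 (T : tfield3) : Prop :=
  (forall a i j k, smooth_on (chart_image a) (T a i j k)) /\
  (forall a b x, overlap (atlas a) (atlas b) x ->
     let phi := transition (atlas a) (atlas b) in
     forall i j k, T a i j k x =
       \sum_l \sum_m \sum_p
         jacobian phi x i l * jacobian phi x j m * jacobian phi x k p
         * T b l m p (phi x)).

(* Pseudo-Riemannian metrics of any signature. *)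
Definition is_metric (g : tfield2) : Prop :=
  is_tensor2 g /\
  (forall a x, chart_image a x ->
     (forall i j, g a i j x = g a j i x) /\ metric_mx (g a) x \in unitmx).

Definition conformally_flat (g : tfield2) : Prop :=
  forall a x, chart_image a x ->
  exists (U : set 'rV[R]_n) (u : 'rV[R]_n -> R),
    [/\ open U, U x, U `<=` chart_image a, smooth_on U u &
        forall y, U y -> forall l k i j,
          riem (levi_civita (fun p q z => expR (2 * u z) * g a p q z))
               l k i j y = 0].

Definition is_cubic (g : tfield2) (S : tfield3) : Prop :=
  is_tensor3 S /\
  (forall a x, chart_image a x ->
     [/\ forall i j k, S a i j k x = S a j i k x,
         forall i j k, S a i j k x = S a i k j x &
         forall k, trg (g a) (fun i j => S a i j k) x = 0]).

Definition abundant_ge3 (g : tfield2) (S : tfield3) (t : M -> R) : Prop :=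
  conformally_flat g /\
  (forall a x, chart_image a x ->
     [/\ hess_eq_ge3 (g a) (S a) (in_chart a t) x,
         cov_eq_ge3 (g a) (S a) (in_chart a t) x &
         weyl_eq_ge3 (g a) (S a) x]).

Definition abundant_2 (g : tfield2) (S : tfield3) (t : M -> R) : Prop :=
  forall a x, chart_image a x ->
     [/\ tau2_tracefree (g a) (S a) (in_chart a t) x,
         cov_eq_2 (g a) (S a) (in_chart a t) x,
         covE_eq_2 (g a) (S a) (in_chart a t) x &
         divtau_eq_2 (g a) (S a) (in_chart a t) x].

Definition abundant (g : tfield2) (S : tfield3) (t : M -> R) : Prop :=
  [/\ is_metric g, is_cubic g S, smooth_map t,
      ((3 <= n)%N -> abundant_ge3 g S t) & (n = 2%N -> abundant_2 g S t)].

(* Points of R^(n+1) are rows of length n + 1. *)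
Section Normalisation.
Variables (f xi : M -> 'rV[R]_(n + 1)).

(* The Gauss-Weingarten decompositions, in the frame whose first n rows are
   the partial derivatives of f and whose last row is xi. *)
Definition frame a (x : 'rV[R]_n) : 'M[R]_(n + 1) :=
  col_mx (jacobian (in_chart a f) x) (in_chart a xi x).

Definition frame_coord a (x : 'rV[R]_n) (v : 'rV[R]_(n + 1)) : 'rV[R]_(n + 1) :=
  v *m invmx (frame a x).

Definition induced_conn a (k i j : 'I_n) (x : 'rV[R]_n) : R :=
  frame_coord a x (pder i (pder j (in_chart a f)) x) 0 (lshift 1 k).

Definition assoc_metric a (i j : 'I_n) (x : 'rV[R]_n) : R :=
  frame_coord a x (pder i (pder j (in_chart a f)) x) 0 (rshift n 0).

Definition Theta a (i : 'I_n) (x : 'rV[R]_n) : R :=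
  frame_coord a x (pder i (in_chart a xi) x) 0 (rshift n 0).

Definition assoc_cubic a (i j k : 'I_n) (x : 'rV[R]_n) : R :=
  \sum_l assoc_metric a l k x *
    (induced_conn a l i j x - levi_civita (assoc_metric a) l i j x).

(* Immersion with a transversal field, both smooth. *)
Definition is_normalisation : Prop :=
  [/\ smooth_map f, smooth_map xi &
      forall a x, chart_image a x ->
        row_free (jacobian (in_chart a f) x) /\
        ~~ (in_chart a xi x <= jacobian (in_chart a f) x)%MS].

Definition is_nondegenerate : Prop :=
  forall a x, chart_image a x -> metric_mx (assoc_metric a) x \in unitmx.

Definition relative_normalisation : Prop :=
  [/\ is_normalisation, is_nondegenerate &
      forall a x, chart_image a x -> forall i, Theta a i x = 0].

Definition graph_normalisation : Prop :=
  relative_normalisation /\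
  exists2 F : M -> R, smooth_map F &
    forall a x, chart_image a x ->
      (forall i j, pder i (pder j (in_chart a f)) x =
         \sum_k induced_conn a k i j x *: pder k (in_chart a f) x
         + hess (induced_conn a) (in_chart a F) i j x *: in_chart a xi x) /\
      (forall i, pder i (in_chart a xi) x = 0).

Definition associated_normalisation
    (g : tfield2) (S : tfield3) (t : M -> R) : Prop :=
  relative_normalisation /\
  forall a x, chart_image a x ->
    let dt i := dfun (in_chart a t) i x in
    (forall i j, assoc_metric a i j x = g a i j x) /\
    (forall i j k, assoc_cubic a i j k x =
       3^-1 * (S a i j k x + dt i * g a j k x + dt j * g a i k x
               + dt k * g a i j x)).

End Normalisation.
End OnManifold.

(* Main.v *)
Require Import Defs.
From HB Require Import structures.
From mathcomp Require Import all_boot all_order all_algebra.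
From mathcomp Require Import all_classical all_reals all_analysis.
From mathcomp Require Import ring lra.

Set Implicit Arguments.
Unset Strict Implicit.
Unset Printing Implicit Defensive.

Import Order.TTheory GRing.Theory Num.Theory.
Import numFieldNormedType.Exports.

Local Open Scope classical_set_scope.
Local Open Scope ring_scope.


(** Why the theorem is true.

A relative normalisation is a graph normalisation exactly when its transversal
field xi is constant.  If xi is constant then, choosing a linear form w on
R^(n+1) with w(xi) = 1, the function F = w(f) has Hessian equal to the
associated metric, because w applied to the Gauss decomposition of d_i d_j f
gives d_i d_j F = Gam^k_ij d_k F + g_ij ([graph_normalisationP]; connectedness
of the manifold makes a field with vanishing derivatives constant).

Write d_i xi = B_i^l d_l f.  The Gauss equation [gauss] says
R^l_kij = g_ik B_j^l - g_jk B_i^l for the curvature of the induced connection.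
Its Ricci contraction is B_jk - g_jk tr B, and since n > 1 this vanishes only if
B does.  So xi is constant if and only if the induced connection is Ricci-flat
([normal_constant_ricci]).

The induced connection is the Levi-Civita connection plus the cubic
C = (S + dt g + dt g + dt g) / 3 with one index raised, so its curvature is that
of g, plus the antisymmetrised covariant derivative of C, plus a quadratic
commutator term ([riem_change]).  Contracting ([mtrace_curv_pcubic],
[ricci_of_cubic]), and writing Q(X, Y) = tr (S_X S_Y),
  Ric(nabla) = Ric(g) + (div S - n Hess t + (Lap t) g) / 3
    + (n + 2) / 9 (S(grad t) + 2 dt dt + |dt|^2 g)
    - (Q + 4 S(grad t) + (n + 6) dt dt + 2 |dt|^2 g) / 9.
What remains is pointwise algebra.

For n > 2, the prescribed covariant derivative of S gives
div S = 2n / (3(n - 2)) Q_o - n/3 S(grad t) ([pdivS_ge3]) and Hess t is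
prescribed as well; everything collapses to
  Ric(nabla) = tau / 3 - 8/3 P_o
               + (Scal - (|S|^2 - (n-1)(n+2) |dt|^2) / 9) g / n
([pricci_ge3]), whose trace-free part and trace are the two stated conditions.

For n = 2, both Q and Ric(g) are pure trace ([pscrS_surface],
[ricci_surface]), div S = E - 2/3 S(grad t) by definition of E, and the trace of
tau determines the Laplacian of t, so that
  Ric(nabla) = 2/3 E - 8/9 (S(grad t) + dt dt - |dt|^2 g / 2) - tau
               + (Scal - (|S|^2 - 4 |dt|^2) / 9) g / 2
([pricci_eq0_2]), with the same conclusion. *)

(** * Symmetry of mixed partial derivatives *)

Section MixedPartials.
Context {R : realType} {V : normedModType R}.
Implicit Types (f : V -> R) (U : set V) (x u v : V).

Lemma is_derive_line f x u (s : R) : derivable f (s *: u + x) u ->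
  is_derive s 1 (fun r : R => f (r *: u + x)) ('D_u f (s *: u + x)).
Proof.
move=> df.
have E : (fun h : R => h^-1 *: (f ((h *: 1 + s) *: u + x) - f (s *: u + x)))
       = (fun h : R => h^-1 *: (f (h *: u + (s *: u + x)) - f (s *: u + x))).
  by rewrite funeqE => h; rewrite [h *: 1]mulr1 scalerDl addrA.
split; first by rewrite /derivable /= E.
by rewrite /derive /= E.
Qed.

(** Applied with u and v exchanged, the same second difference is compared with
both iterated derivatives, which are therefore equal.  The mean value theorem
along u leaves a difference of two values of D_u f, which the differentiability
of D_u f at x evaluates. *)
Lemma second_difference f U x u v :
    open U -> U x -> (forall y, U y -> derivable f y u) ->
    differentiable ('D_u f) x ->
  forall e, 0 < e -> \forall h \near (0 : R)^'+,
    `|f (h *: u + (h *: v + x)) - f (h *: u + x) - f (h *: v + x) + f x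
      - h ^+ 2 * 'D_v ('D_u f) x| <= e * h ^+ 2.
Proof.
move=> oU Ux df ddf e e0.
set psi := 'D_u f.
set N := `|u| + `|u| + `|v| + 1.
have N0 : 0 < N by rewrite /N ltr_wpDl // !addr_ge0.
have eN : 0 < e / N by rewrite divr_gt0.
have small : \forall k \near (0 : V),
    `|psi (k + x) - psi x - 'd psi x k| <= e / N * `|k|.
  have /eqaddoP/(_ _ eN) := diff_locally ddf.
  apply: filterS => k /=.
  by rewrite !fctE /= opprD addrA.
have /nbhs_ballP[d1 /= d10 B1] := small.
have /nbhs_ballP[d2 /= d20 B2] : nbhs x U by exact: open_nbhs_nbhs.
set d := Num.min d1 d2.
have d0 : 0 < d by rewrite lt_min d10.
near=> h.
have h0 : 0 < h by [].
have hN : h * N < d.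
  rewrite -ltr_pdivlMr //; near: h.
  by apply: nbhs_right_lt; rewrite divr_gt0.
(* The whole parallelogram spanned by h u and h v lies in the region where the
   estimate [small] holds and inside U. *)
have sz r s : 0 <= r <= h -> 0 <= s <= h -> `|r *: u + s *: v| <= h * (`|u| + `|v|).
  move=> /andP[r0 rh] /andP[s0 sh].
  rewrite (le_trans (ler_normD _ _)) // !normrZ !ger0_norm // mulrDr.
  by rewrite lerD // ler_wpM2r.
have szd r s : 0 <= r <= h -> 0 <= s <= h -> `|r *: u + s *: v| < d.
  move=> hr hs; apply: le_lt_trans (sz _ _ hr hs) (le_lt_trans _ hN).
  by rewrite ler_pM2l // /N; have := normr_ge0 u; lra.
have inU r s : 0 <= r <= h -> 0 <= s <= h -> U (r *: u + (s *: v + x)).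
  move=> hr hs; apply: B2; rewrite -ball_normE /= addrA opprD addrCA subrr addr0.
  by rewrite normrN (lt_le_trans (szd _ _ hr hs)) // ge_min lexx orbT.
have hh : (0 : R) <= h <= h by rewrite lexx ltW.
have h00 : (0 : R) <= 0 <= h by rewrite lexx ltW.
pose phi (r : R) := f (r *: u + (h *: v + x)) - f (r *: u + x).
pose dphi (r : R) := psi (r *: u + (h *: v + x)) - psi (r *: u + x).
have dphiP r : 0 <= r <= h -> is_derive r 1 phi (dphi r).
  move=> hr; apply: is_deriveB; apply: is_derive_line; apply: df.
    exact: inU.
  by have := inU r 0 hr h00; rewrite scale0r add0r.
have [c] : exists2 c, c \in `]0, h[%R & phi h - phi 0 = dphi c * (h - 0).
  apply: MVT => //.
    by move=> r; rewrite in_itv /= => /andP[? ?]; apply: dphiP; rewrite !ltW.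
  apply: derivable_within_continuous => r; rewrite in_itv /= => hr.
  by case: (dphiP r hr).
rewrite in_itv /= subr0 => /andP[c0 ch] Ephi.
have hc : 0 <= c <= h by rewrite !ltW.
have -> : f (h *: u + (h *: v + x)) - f (h *: u + x) - f (h *: v + x) + f x
          = dphi c * h.
  rewrite -Ephi /phi !scale0r !add0r.
  by rewrite opprB addrA -!addrA; congr (_ + (_ + _)); rewrite addrC.
have bnd r s : 0 <= r <= h -> 0 <= s <= h ->
    `|psi (r *: u + s *: v + x) - psi x - 'd psi x (r *: u + s *: v)|
      <= e / N * `|r *: u + s *: v|.
  move=> hr hs; apply: B1.
  rewrite -ball_normE /= sub0r normrN.
  by rewrite (lt_le_trans (szd _ _ hr hs)) // ge_min lexx.
have b1 := bnd c h hc hh; have b2 := bnd c 0 hc h00.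
rewrite scale0r addr0 in b2.
rewrite (deriveE _ ddf) -/psi.
have -> : dphi c * h - h ^+ 2 * 'd psi x v =
   h * ((psi (c *: u + h *: v + x) - psi x - 'd psi x (c *: u + h *: v))
        - (psi (c *: u + x) - psi x - 'd psi x (c *: u))).
  have -> : 'd psi x (c *: u + h *: v) = 'd psi x (c *: u) + h * 'd psi x v.
    by rewrite linearD; congr (_ + _); rewrite linearZ.
  by rewrite /dphi !addrA; ring.
rewrite normrM (gtr0_norm h0) expr2 mulrCA ler_pM2l //.
apply: (le_trans (ler_normB _ _)).
apply: (le_trans (lerD b1 b2)).
have sc : `|c *: u| <= h * `|u|.
  by rewrite normrZ gtr0_norm // ler_wpM2r // ltW.
have suv := sz c h hc hh.
apply: (@le_trans _ _ (e / N * (h * (`|u| + `|v|)) + e / N * (h * `|u|))).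
  by apply: lerD; rewrite ler_pM2l.
have le : h * (`|u| + `|v|) + h * `|u| <= N * h.
  by rewrite -mulrDr mulrC ler_pM2r // /N; lra.
have -> : e * h = e / N * (N * h) by rewrite mulrA divfK // gt_eqF.
by rewrite -mulrDr ler_pM2l.
Unshelve. all: by end_near.
Qed.

(** Young's form of the symmetry of second derivatives: it suffices that the two
first derivatives are differentiable at the point. *)
Lemma deriveC f U x u v :
    open U -> U x ->
    (forall y, U y -> differentiable f y) ->
    differentiable ('D_u f) x -> differentiable ('D_v f) x ->
  'D_v ('D_u f) x = 'D_u ('D_v f) x.
Proof.
move=> oU Ux df du dv.
apply/eqP; rewrite -subr_eq0 -normr_le0; apply/ler_addgt0Pl => e e0; rewrite addr0.
have e2 : 0 < e / 2 by rewrite divr_gt0.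
have H1 := second_difference v oU Ux
  (fun y Uy => diff_derivable (df y Uy)) du e2.
have H2 := second_difference u oU Ux
  (fun y Uy => diff_derivable (df y Uy)) dv e2.
near (0 : R)^'+ => h.
have h0 : 0 < h by [].
have b1 := near H1 h; have b2 := near H2 h.
have := lerD (b2 _) (b1 _).
rewrite -mulrDl -splitr => /(_ ltac:(by []) ltac:(by [])) b.
have h2 : 0 < h ^+ 2 by rewrite exprn_gt0.
rewrite -(ler_pM2r h2) -[X in _ * X <= _](gtr0_norm h2) -normrM.
apply: le_trans b; apply: le_trans (ler_normB _ _).
rewrite [h *: v + (h *: u + x)]addrCA.
have E (a b c d p q k : R) :
  (p - q) * k = a - b - c + d - k * q - (a - c - b + d - k * p) by ring.
by rewrite -E.
Unshelve. all: by end_near.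
Qed.

End MixedPartials.

(** * Partial derivatives of scalar and vector functions *)

Lemma near_eq_differentiable (R : realType) (V W : normedModType R)
    (f g : V -> W) (x : V) :
  {near x, f =1 g} -> differentiable f x -> differentiable g x.
Proof.
move=> fg df.
have E : g \o shift x = cst (g x) + 'd f x +o_ 0 id.
  apply/eqaddoP => e e0.
  have /eqaddoP/(_ _ e0) := diff_locally df.
  move: (nbhs_singleton fg) (fg) => fgx.
  rewrite (near_shift 0 x) subr0 => fg'.
  by apply: filterS2 fg' => k /= fgk; rewrite !fctE /= fgk fgx.
have D : 'd g x = 'd f x :> (V -> W).
  by apply: diff_unique => //; exact: diff_continuous.
by apply/diff_locallyP; rewrite D; split=> //; exact: diff_continuous.
Qed.

Section Pder.
Context {R : realType} {n : nat} {V : normedModType R}.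
Implicit Types (U : set 'rV[R]_n) (f g : 'rV[R]_n -> V).

(** The existence of all first partial derivatives is the hypothesis under
which the tensor calculus below computes them. *)
Definition pderivable f x := forall i, derivable f x (delta_mx 0 i).

Lemma differentiable_pderivable f x : differentiable f x -> pderivable f x.
Proof. by move=> df i; apply: diff_derivable. Qed.

Lemma eq_near U f g x : open U -> U x -> (forall y, U y -> f y = g y) ->
  {near x, f =1 g}.
Proof. by move=> oU Ux fg; apply: filterS (open_nbhs_nbhs (conj oU Ux)). Qed.

Lemma pder_eq_on U f g i x : open U -> U x -> (forall y, U y -> f y = g y) ->
  pder i f x = pder i g x.
Proof. by move=> oU Ux fg; apply: near_eq_derive; exact: eq_near oU Ux fg. Qed.

Lemma pderivable_eq_on U f g x : open U -> U x -> (forall y, U y -> f y = g y) ->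
  pderivable f x -> pderivable g x.
Proof.
by move=> oU Ux fg df i; apply: near_eq_derivable (df i); exact: eq_near oU Ux fg.
Qed.

Lemma Ck_on_eq k U f g : open U -> (forall y, U y -> f y = g y) ->
  Ck_on k U f -> Ck_on k U g.
Proof.
move=> oU; elim: k f g => [|k IH] f g fg /=.
  move=> fc x Ux; have := fc x Ux; rewrite /prop_for /continuous_at (fg x) //.
  exact: (cvg_trans (near_eq_cvg (eq_near oU Ux fg))).
move=> [df dk]; split=> [x Ux|i].
  by apply: near_eq_differentiable (df x Ux); exact: eq_near oU Ux fg.
by apply: IH (dk i) => y Uy; exact: pder_eq_on oU Uy fg.
Qed.

Lemma smooth_on_differentiable U f x : smooth_on U f -> U x -> differentiable f x.
Proof. by move=> /(_ 1%N)[df _] /df. Qed.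

Lemma smooth_on_pder U f i : smooth_on U f -> smooth_on U (pder i f).
Proof. by move=> sf k; have [_] := sf k.+1; apply. Qed.

Lemma pderD f g i x : pderivable f x -> pderivable g x ->
  pder i (fun y => f y + g y) x = pder i f x + pder i g x.
Proof. by move=> df dg; exact: deriveD. Qed.

Lemma pderivableD f g x : pderivable f x -> pderivable g x ->
  pderivable (fun y => f y + g y) x.
Proof. by move=> df dg i; exact: derivableD. Qed.

Lemma pderivableB f g x : pderivable f x -> pderivable g x ->
  pderivable (fun y => f y - g y) x.
Proof. by move=> df dg i; exact: derivableB. Qed.

Lemma pderivable_cst (c : V) (x : 'rV[R]_n) : pderivable (fun=> c) x.
Proof. by move=> i; exact: derivable_cst. Qed.

Lemma pder_cst (c : V) i (x : 'rV[R]_n) : pder i (fun=> c) x = 0.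
Proof. exact: derive_cst. Qed.

Lemma pderivable_sum (I : finType) (F : I -> 'rV[R]_n -> V) x :
  (forall a, pderivable (F a) x) -> pderivable (fun y => \sum_a F a y) x.
Proof.
move=> dF; elim: (index_enum I) => [|a r IH].
  by under eq_fun do rewrite big_nil; exact: pderivable_cst.
by under eq_fun do rewrite big_cons; exact: pderivableD.
Qed.

Lemma pder_sum (I : finType) (F : I -> 'rV[R]_n -> V) i x :
  (forall a, pderivable (F a) x) ->
  pder i (fun y => \sum_a F a y) x = \sum_a pder i (F a) x.
Proof.
move=> dF.
suff [] : pder i (fun y => \sum_a F a y) x = \sum_a pder i (F a) x
  /\ pderivable (fun y => \sum_a F a y) x by [].
elim: (index_enum I) => [|a r [IH1 IH2]].
  under eq_fun do rewrite big_nil; rewrite big_nil pder_cst.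
  by split=> //; exact: pderivable_cst.
under eq_fun do rewrite big_cons; rewrite big_cons pderD // IH1.
by split=> //; exact: pderivableD.
Qed.

End Pder.

Section PderScalar.
Context {R : realType} {n : nat}.
Implicit Types (U : set 'rV[R]_n) (f g : 'rV[R]_n -> R).

Lemma pderM f g i x : pderivable f x -> pderivable g x ->
  pder i (fun y => f y * g y) x = pder i f x * g x + f x * pder i g x.
Proof.
by move=> df dg; rewrite /pder (deriveM (df i) (dg i)) addrC mulrC.
Qed.

Lemma pderivableM f g x : pderivable f x -> pderivable g x ->
  pderivable (fun y => f y * g y) x.
Proof. by move=> df dg i; exact: derivableM. Qed.

Lemma pderivable_prod (I : finType) (F : I -> 'rV[R]_n -> R) x :
  (forall a, pderivable (F a) x) -> pderivable (fun y => \prod_a F a y) x.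
Proof.
move=> dF; elim: (index_enum I) => [|a r IH].
  by under eq_fun do rewrite big_nil; exact: pderivable_cst.
by under eq_fun do rewrite big_cons; exact: pderivableM.
Qed.

Lemma pderivable_det m (A : 'rV[R]_n -> 'M[R]_m) x :
  (forall i j, pderivable (fun y => A y i j) x) ->
  pderivable (fun y => \det (A y)) x.
Proof.
move=> dA; apply: pderivable_sum => s; apply: pderivableM.
  exact: pderivable_cst.
by apply: pderivable_prod => i.
Qed.

(** By Cramer's rule the entries are cofactors divided by the determinant. *)
Lemma pderivable_invmx m (A : 'rV[R]_n -> 'M[R]_m) U x i j :
  open U -> U x -> (forall y, U y -> A y \in unitmx) ->
  (forall i j, pderivable (fun y => A y i j) x) ->
  pderivable (fun y => invmx (A y) i j) x.
Proof.
move=> oU Ux uA dA.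
apply: (@pderivable_eq_on _ _ _ U (fun y => (\det (A y))^-1 * (\adj (A y)) i j)) => //.
  by move=> y Uy; rewrite /invmx uA // !mxE.
apply: pderivableM.
  move=> k; apply: derivableV; last exact: pderivable_det.
  by have := uA x Ux; rewrite unitmxE unitfE.
under eq_fun do rewrite mxE /cofactor.
apply: pderivableM; first exact: pderivable_cst.
apply: pderivable_det => k l; under eq_fun do rewrite !mxE; exact: dA.
Qed.

Lemma pderC U f i j x : open U -> U x -> smooth_on U f ->
  pder i (pder j f) x = pder j (pder i f) x.
Proof.
move=> oU Ux sf; apply: (deriveC oU Ux).
- by move=> y; exact: smooth_on_differentiable sf.
- by apply: smooth_on_differentiable Ux; exact: smooth_on_pder.
- by apply: smooth_on_differentiable Ux; exact: smooth_on_pder.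
Qed.

End PderScalar.

Section PderVector.
Context {R : realType} {n m : nat}.
Implicit Types (U : set 'rV[R]_n) (F : 'rV[R]_n -> 'rV[R]_m).

Lemma pderivable_coord F x c : pderivable F x -> pderivable (fun y => F y 0 c) x.
Proof. by move=> dF i; exact: ((derivable_mxP _ _ _).1 (dF i)). Qed.

Lemma Ck_on_linear (W W' : normedModType R) (L : {linear W -> W'}) k U
    (F : 'rV[R]_n -> W) : continuous L -> open U ->
  Ck_on k U F -> Ck_on k U (L \o F).
Proof.
move=> cL oU; elim: k F => [|k IH] F /=.
  by move=> cF x Ux; apply: continuous_comp; [exact: cF|exact: cL].
move=> [dF kF]; split=> [x Ux|i].
  by apply: differentiable_comp; [exact: dF|exact: linear_differentiable].
apply: Ck_on_eq (IH _ (kF i)) => // y Uy /=.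
rewrite /pder [RHS]deriveE; last first.
  by apply: differentiable_comp; [exact: dF|exact: linear_differentiable].
rewrite diff_comp //; [|exact: dF|exact: linear_differentiable].
by rewrite /= diff_lin // deriveE //; exact: dF.
Qed.

End PderVector.

(** * Traces with respect to a metric *)

(** Pointwise tensors are bare functions of indices; h plays the role of the
inverse metric.  Unfolding the trace of a tensor field at a point gives exactly
this double sum, so the two are interchangeable by conversion. *)
Definition mtrace (R : pzRingType) (n : nat) (h b : 'I_n -> 'I_n -> R) : R :=
  \sum_i \sum_j h i j * b i j.

Section Contraction.
Context {R : realFieldType} {n : nat}.
Variables (g h : 'I_n -> 'I_n -> R).
Hypothesis gC : forall i j, g i j = g j i.
Hypothesis hC : forall i j, h i j = h j i.
Hypothesis hg : forall i j, \sum_l h i l * g l j = (i == j)%:R.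

Local Notation tr := (mtrace h).

Lemma eq_mtrace b c : (forall i j, b i j = c i j) -> tr b = tr c.
Proof. by move=> bc; do 2![apply: eq_bigr => ? _]; rewrite bc. Qed.

Lemma mtraceD b c : tr (fun i j => b i j + c i j) = tr b + tr c.
Proof.
rewrite /mtrace -big_split; apply: eq_bigr => i _.
by rewrite -big_split; apply: eq_bigr => j _; rewrite mulrDr.
Qed.

Lemma mtraceZ a b : tr (fun i j => a * b i j) = a * tr b.
Proof.
rewrite /mtrace mulr_sumr; apply: eq_bigr => i _.
by rewrite mulr_sumr; apply: eq_bigr => j _; rewrite mulrCA.
Qed.

Lemma mtraceZr a b : tr (fun i j => b i j * a) = tr b * a.
Proof. by rewrite mulrC -mtraceZ; apply: eq_mtrace => i j; rewrite mulrC. Qed.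

Lemma mtraceN b : tr (fun i j => - b i j) = - tr b.
Proof.
by rewrite -mulN1r -mtraceZ; apply: eq_mtrace => i j; rewrite mulN1r.
Qed.

Lemma mtraceB b c : tr (fun i j => b i j - c i j) = tr b - tr c.
Proof. by rewrite mtraceD mtraceN. Qed.

Lemma mtrace0 : tr (fun _ _ => 0) = 0.
Proof. by rewrite /mtrace big1 // => i _; rewrite big1 // => j _; rewrite mulr0. Qed.

Lemma mtrace_swap b : tr (fun i j => b j i) = tr b.
Proof.
by rewrite /mtrace exchange_big; apply: eq_bigr => i _; apply: eq_bigr => j _; rewrite hC.
Qed.

Lemma mtrace_exchange (B : 'I_n -> 'I_n -> 'I_n -> 'I_n -> R) :
  tr (fun i j => tr (B i j)) = tr (fun k l => tr (fun i j => B i j k l)).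
Proof.
rewrite /mtrace; under eq_bigr => i _ do under eq_bigr => j _ do rewrite mulr_sumr.
under [RHS]eq_bigr => i _ do under eq_bigr => j _ do rewrite mulr_sumr.
under eq_bigr => i _ do rewrite exchange_big.
rewrite exchange_big /=; apply: eq_bigr => k _.
under eq_bigr => i _ do under eq_bigr => j _ do rewrite mulr_sumr.
under [RHS]eq_bigr => i _ do under eq_bigr => j _ do rewrite mulr_sumr.
under eq_bigr => i _ do rewrite exchange_big.
rewrite exchange_big /=; apply: eq_bigr => l _.
by do 2![apply: eq_bigr => ? _]; rewrite mulrCA.
Qed.

Lemma sum_delta (X : 'I_n -> R) j : \sum_i (i == j)%:R * X i = X j.
Proof.
rewrite (bigD1 j) //= eqxx mul1r big1 ?addr0 // => i /negbTE ->.
by rewrite mul0r.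
Qed.

Lemma mtrace_gr X j : tr (fun i k => X i * g k j) = X j.
Proof.
rewrite -[RHS]sum_delta /mtrace; apply: eq_bigr => i _.
by rewrite -hg mulr_suml; apply: eq_bigr => l _; ring.
Qed.

Lemma mtrace_gl X j : tr (fun i k => g i j * X k) = X j.
Proof.
by rewrite -[RHS](mtrace_gr X) -mtrace_swap; apply: eq_mtrace => i k; rewrite mulrC.
Qed.

Lemma mtrace_g : tr (fun i k => g i k) = n%:R.
Proof.
rewrite /mtrace; under eq_bigr => i _ do under eq_bigr => j _ do rewrite gC.
under eq_bigr => i _ do rewrite hg eqxx.
by rewrite sumr_const card_ord.
Qed.

(** Computes a Ricci contraction from a curvature tensor with its upper index
lowered. *)
Lemma mtrace_lower (X : 'I_n -> 'I_n -> R) :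
  tr (fun i m => \sum_l g l m * X i l) = \sum_i X i i.
Proof.
apply: eq_bigr => i _; rewrite -[RHS](sum_delta (X i)).
under eq_bigr => m _ do rewrite mulr_sumr.
rewrite exchange_big; apply: eq_bigr => l _ /=.
rewrite eq_sym -hg mulr_suml; apply: eq_bigr => m _.
by rewrite (gC l); ring.
Qed.

Lemma raise_lower (X : 'I_n -> R) l :
  \sum_p h l p * \sum_k g k p * X k = X l.
Proof.
rewrite -[RHS](sum_delta X).
under eq_bigr => p _ do rewrite mulr_sumr.
rewrite exchange_big; apply: eq_bigr => k _ /=.
rewrite eq_sym -hg mulr_suml; apply: eq_bigr => p _.
by rewrite (gC k); ring.
Qed.

Lemma sum_mtraceE (X Y : 'I_n -> R) :
  \sum_l X l * (\sum_m h l m * Y m) = tr (fun l m => X l * Y m).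
Proof.
by apply: eq_bigr => l _; rewrite mulr_sumr; apply: eq_bigr => m _; ring.
Qed.

Section Cubic.
Variables (t : 'I_n -> R) (S : 'I_n -> 'I_n -> 'I_n -> R).
Hypothesis S12 : forall i j k, S i j k = S j i k.
Hypothesis S23 : forall i j k, S i j k = S i k j.
Hypothesis S_tr : forall k, tr (fun i j => S i j k) = 0.

(** A leading p marks the value at a point of the tensor field of the same name:
[pcubic] is the cubic of an abundant manifold, [pscrS] is the form tr (S_X S_Y)
and [pcontr2] is S(grad t). *)
Definition pcubic i j k := 3^-1 * (S i j k + t i * g j k + t j * g i k + t k * g i j).
Definition pcontr2 j k := tr (fun l p => S j k p * t l).
Definition pnorm2 := tr (fun l p => t l * t p).
Definition pscrS j k := tr (fun i m => tr (fun l p => S i k p * S j l m)).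

Lemma S13 i j k : S i j k = S k j i.
Proof. by rewrite S12 S23 S12. Qed.

Lemma S_trace13 k : tr (fun i j => S i k j) = 0.
Proof. by rewrite -(S_tr k); apply: eq_mtrace => i j; rewrite S23. Qed.

Lemma S_trace23 k : tr (fun i j => S k i j) = 0.
Proof. by rewrite -(S_tr k); apply: eq_mtrace => i j; rewrite S12 S23. Qed.

(** The trace of the composition of two endomorphisms S_X, whose entries have one
index raised. *)
Lemma pscrS_hat p q :
  \sum_a \sum_b (\sum_c h a c * S p b c) * (\sum_d h b d * S q a d) = pscrS p q.
Proof.
rewrite /pscrS /mtrace; apply: eq_bigr => a _.
under eq_bigr => b _ do rewrite mulr_suml.
rewrite exchange_big; apply: eq_bigr => c _.
rewrite mulr_sumr; apply: eq_bigr => b _.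
rewrite !mulr_sumr; apply: eq_bigr => d _.
by rewrite (S12 q); ring.
Qed.

Lemma pcontr2C j k : pcontr2 j k = pcontr2 k j.
Proof. by apply: eq_mtrace => l p; rewrite S12. Qed.

Lemma mtrace_pcontr2 : tr pcontr2 = 0.
Proof.
rewrite /pcontr2 mtrace_exchange -mtrace0; apply: eq_mtrace => l p.
by rewrite mtraceZr S_tr mul0r.
Qed.

Lemma mtrace_pcubic k : tr (fun i m => pcubic i k m) = (n%:R + 2) / 3 * t k.
Proof.
have E i m : pcubic i k m = 3^-1 * (S i k m + t i * g m k + t k * g i m + g i k * t m).
  by rewrite /pcubic (gC k); ring.
rewrite (eq_mtrace E) mtraceZ !mtraceD S_trace13 mtrace_gr mtraceZ mtrace_g mtrace_gl.
ring.
Qed.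

Lemma pcubic_grad j k : tr (fun l p => pcubic j k p * t l) =
  3^-1 * (pcontr2 j k + 2 * (t j * t k) + pnorm2 * g j k).
Proof.
have E l p : pcubic j k p * t l =
    3^-1 * (S j k p * t l + t j * (t l * g p k) + t k * (t l * g p j)
            + g j k * (t l * t p)) by rewrite /pcubic (gC j p) (gC k p); ring.
rewrite (eq_mtrace E) mtraceZ !mtraceD !mtraceZ !mtrace_gr -/pnorm2 -/(pcontr2 _ _); ring.
Qed.

Lemma pcubic_S j k : tr (fun i m => tr (fun l p => pcubic i k p * S j l m)) =
  3^-1 * (pscrS j k + 2 * pcontr2 j k).
Proof.
have E i m : tr (fun l p => pcubic i k p * S j l m) =
    3^-1 * (tr (fun l p => S i k p * S j l m) + S j k m * t i + t k * S j i m
            + tr (fun l p => g i k * S j l m * t p)).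
  have e l p : pcubic i k p * S j l m = 3^-1 * (S i k p * S j l m
     + t i * (S j l m * g p k) + t k * (S j l m * g p i) + g i k * S j l m * t p).
    by rewrite /pcubic (gC i p) (gC k p); ring.
  by rewrite (eq_mtrace e) mtraceZ !mtraceD !mtraceZ !mtrace_gr; ring.
rewrite (eq_mtrace E) mtraceZ !mtraceD mtraceZ S_trace23 mtrace_exchange [X in _ + X]mtrace_exchange.
have -> : tr (fun i m => S j k m * t i) = pcontr2 j k by [].
have -> : tr (fun l p => tr (fun i m => g i k * S j l m * t p)) = pcontr2 j k.
  rewrite -[RHS]mtrace_swap; apply: eq_mtrace => l p.
  by rewrite mtraceZr mtrace_gl S23.
rewrite -mtrace_exchange -/(pscrS j k); ring.
Qed.

(** The two quadratic terms of the Ricci contraction.  In this one the traced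
factor is a multiple of dt; in the next one both factors keep a free index. *)
Lemma pcubic_quad_traced j k : tr (fun i m => tr (fun l p => pcubic j k p * pcubic i l m)) =
  (n%:R + 2) / 9 * (pcontr2 j k + 2 * (t j * t k) + pnorm2 * g j k).
Proof.
rewrite mtrace_exchange.
have E l p : tr (fun i m => pcubic j k p * pcubic i l m)
    = (n%:R + 2) / 3 * (pcubic j k p * t l) by rewrite mtraceZ mtrace_pcubic; ring.
by rewrite (eq_mtrace E) mtraceZ pcubic_grad; field.
Qed.

Lemma pcubic_quad_crossed j k : tr (fun i m => tr (fun l p => pcubic i k p * pcubic j l m)) =
  9^-1 * (pscrS j k + 4 * pcontr2 j k + (n%:R + 6) * (t j * t k) + 2 * pnorm2 * g j k).
Proof.
have E i m : tr (fun l p => pcubic i k p * pcubic j l m) =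
    3^-1 * (tr (fun l p => pcubic i k p * S j l m) + t j * pcubic i k m
            + g m j * tr (fun l p => pcubic i k p * t l) + pcubic j k i * t m).
  have e l p : pcubic i k p * pcubic j l m = 3^-1 * (pcubic i k p * S j l m
     + t j * (g l m * pcubic i k p) + g m j * (pcubic i k p * t l)
     + t m * (g l j * pcubic i k p)).
    by rewrite {2}/pcubic (gC j m) (gC j l); ring.
  rewrite (eq_mtrace e) mtraceZ !mtraceD !mtraceZ !mtrace_gl.
  have -> : pcubic i k j = pcubic j k i by rewrite /pcubic S13 (gC i j) (gC i k) (gC k j); ring.
  ring.
rewrite (eq_mtrace E) mtraceZ !mtraceD mtraceZ mtrace_pcubic pcubic_S.
have -> : tr (fun i m => g m j * tr (fun l p => pcubic i k p * t l)) =
    3^-1 * (pcontr2 j k + 2 * (t j * t k) + pnorm2 * g j k).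
  rewrite -pcubic_grad -(mtrace_gr (fun i => tr (fun l p => pcubic i k p * t l)) j).
  by apply: eq_mtrace => i m; rewrite mulrC.
have -> : tr (fun i m => pcubic j k i * t m) =
    3^-1 * (pcontr2 j k + 2 * (t j * t k) + pnorm2 * g j k).
  by rewrite -pcubic_grad -mtrace_swap.
by field.
Qed.

(** The Leibniz rule for the cubic, when the covariant derivative of g vanishes:
G are the connection coefficients in one fixed direction, dt, dSijk and dg the
partial derivatives in that direction. *)
Lemma pcov_pcubic (G : 'I_n -> 'I_n -> R) (dt : 'I_n -> R) dSijk dg i j k :
  (forall a b, dg a b = \sum_l G l a * g l b + \sum_l G l b * g a l) ->
  3^-1 * (dSijk + (dt i * g j k + t i * dg j k) + (dt j * g i k + t j * dg i k)
          + (dt k * g i j + t k * dg i j))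
  - \sum_l G l i * pcubic l j k - \sum_l G l j * pcubic i l k - \sum_l G l k * pcubic i j l
  = 3^-1 * (dSijk - \sum_l G l i * S l j k - \sum_l G l j * S i l k
              - \sum_l G l k * S i j l
            + (dt i - \sum_l G l i * t l) * g j k
            + (dt j - \sum_l G l j * t l) * g i k
            + (dt k - \sum_l G l k * t l) * g i j).
Proof.
move=> dgE; rewrite !dgE.
have lin a (X : 'I_n -> R) (F1 F2 F3 F4 : 'I_n -> R) (X2 X3 X4 : R) :
    (forall l, X l = 3^-1 * (F1 l + F2 l * X2 + F3 l * X3 + F4 l * X4)) ->
   \sum_l G l a * X l
   = 3^-1 * (\sum_l G l a * F1 l + (\sum_l G l a * F2 l) * X2
     + (\sum_l G l a * F3 l) * X3 + (\sum_l G l a * F4 l) * X4).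
  move=> XE; rewrite !mulr_suml -!big_split mulr_sumr.
  by apply: eq_bigr => l _ /=; rewrite XE; ring.
rewrite (lin i (fun l => pcubic l j k) (fun l => S l j k) t (fun l => g l k) (fun l => g l j) (g j k) (t j) (t k));
  last by move=> l; rewrite /pcubic; ring.
rewrite (lin j (fun l => pcubic i l k) (fun l => S i l k) (fun l => g l k) t (fun l => g i l) (t i) (g i k) (t k));
  last by move=> l; rewrite /pcubic; ring.
rewrite (lin k (fun l => pcubic i j l) (fun l => S i j l) (fun l => g j l) (fun l => g i l) t (t i) (t j) (g i j));
  last by move=> l; rewrite /pcubic; ring.
ring.
Qed.

(* DS and H stand for the covariant derivatives of S and of dt. *)
Variables (DS : 'I_n -> 'I_n -> 'I_n -> 'I_n -> R) (H : 'I_n -> 'I_n -> R).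
Hypothesis DS12 : forall w i j k, DS w i j k = DS w j i k.
Hypothesis DS23 : forall w i j k, DS w i j k = DS w i k j.
Hypothesis DS_tr : forall w k, tr (fun i j => DS w i j k) = 0.
Hypothesis HC : forall i j, H i j = H j i.

Definition pcov_cubic i j k m :=
  3^-1 * (DS i j k m + H i j * g k m + H i k * g j m + H i m * g j k).
Definition pdivS j k := tr (fun i m => DS i m j k).

Lemma mtrace_pdivS : tr pdivS = 0.
Proof.
rewrite /pdivS mtrace_exchange -mtrace0; apply: eq_mtrace => i m.
rewrite -(DS_tr i m); apply: eq_mtrace => j k.
by rewrite DS12 DS23.
Qed.

(** The contraction of the difference of the two lowered curvatures, see
[riem_change].  The divergence of S enters through the first term only, since S
stays trace-free under differentiation; the Laplacian of t enters through the
contraction of the derivative index with the index of dt. *)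
Lemma mtrace_curv_pcubic j k :
  tr (fun i m => pcov_cubic i j k m - pcov_cubic j i k m
       + (tr (fun l p => pcubic j k p * pcubic i l m)
          - tr (fun l p => pcubic i k p * pcubic j l m))) =
  3^-1 * (pdivS j k - n%:R * H j k + tr H * g j k)
  + (n%:R + 2) / 9 * (pcontr2 j k + 2 * (t j * t k) + pnorm2 * g j k)
  - 9^-1 * (pscrS j k + 4 * pcontr2 j k + (n%:R + 6) * (t j * t k) + 2 * pnorm2 * g j k).
Proof.
rewrite mtraceD mtraceB mtraceB pcubic_quad_traced pcubic_quad_crossed /pcov_cubic !mtraceZ !mtraceD.
have -> : tr (fun i m => DS i j k m) = pdivS j k.
  by apply: eq_mtrace => i m; rewrite DS23 DS12.
have -> : tr (fun i m => DS j i k m) = 0.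
  by rewrite -(DS_tr j k); apply: eq_mtrace => i m; rewrite DS23.
have -> : tr (fun i m => H i j * g k m) = H j k.
  rewrite HC -[RHS](mtrace_gr (fun i => H i j) k); apply: eq_mtrace => i m.
  by rewrite (gC k).
have -> : tr (fun i m => H i k * g j m) = H j k.
  rewrite -[RHS](mtrace_gr (fun i => H i k) j); apply: eq_mtrace => i m.
  by rewrite (gC j).
have -> : tr (fun i m => H j i * g k m) = H j k.
  rewrite -[RHS](mtrace_gr (fun i => H j i) k); apply: eq_mtrace => i m.
  by rewrite (gC k).
have -> : tr (fun i m => H j k * g i m) = n%:R * H j k.
  by rewrite mtraceZ mtrace_g mulrC.
have -> : tr (fun i m => H j m * g i k) = H j k.
  rewrite -[RHS](mtrace_gl (fun i => H j i) k); apply: eq_mtrace => i m.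
  by rewrite mulrC.
rewrite mtraceZr; ring.
Qed.

End Cubic.
End Contraction.

(** * The divergence of the cubic form *)

Section Projection.
Context {R : realFieldType} {n : nat}.
Variables (g h : 'I_n -> 'I_n -> R).
Hypothesis gC : forall i j, g i j = g j i.
Hypothesis hC : forall i j, h i j = h j i.
Hypothesis hg : forall i j, \sum_l h i l * g l j = (i == j)%:R.
Local Notation tr := (mtrace h).
Local Notation tens3 := ('I_n -> 'I_n -> 'I_n -> R).

Definition psym3 (T : tens3) i j k :=
  6^-1 * (T i j k + T i k j + T j i k + T j k i + T k i j + T k j i).

Definition psym30 (T : tens3) i j k :=
  let theta l := tr (fun a b => psym3 T a b l) in
  psym3 T i j k
  - (n%:R + 2)^-1 * (g i j * theta k + g i k * theta j + g j k * theta i).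

Lemma eq_psym30 T T' i j k : (forall a b c, T a b c = T' a b c) ->
  psym30 T i j k = psym30 T' i j k.
Proof.
move=> TT; suff -> : T = T' by [].
by apply/funext => a; apply/funext => b; apply/funext.
Qed.

Lemma psym30_12 T i j k : psym30 T i j k = psym30 T j i k.
Proof. by rewrite /psym30 /= /psym3 (gC i j); ring. Qed.

Lemma psym30_23 T i j k : psym30 T i j k = psym30 T i k j.
Proof. by rewrite /psym30 /= /psym3 (gC j k); ring. Qed.

Lemma n2_neq0 : n%:R + 2 != 0 :> R.
Proof. by rewrite -natrD pnatr_eq0 addn2. Qed.

(** The factor n + 2 is what makes the correction terms cancel the trace: one
contraction yields n theta, the other two theta each. *)
Lemma mtrace_psym30 T k : tr (fun i j => psym30 T i j k) = 0.
Proof.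
rewrite /psym30 /=; set theta := fun l => mtrace h (fun a b => psym3 T a b l).
have E i j : psym3 T i j k - (n%:R + 2)^-1 *
      (g i j * theta k + g i k * theta j + g j k * theta i)
    = psym3 T i j k - (n%:R + 2)^-1 *
      (g i j * theta k + g i k * theta j + theta i * g j k) by ring.
rewrite (eq_mtrace h E) mtraceB -[mtrace h (fun i j => psym3 T i j k)]/(theta k).
rewrite mtraceZ !mtraceD mtraceZr (mtrace_g gC hg) (mtrace_gl hC hg) (mtrace_gr hg).
field; exact: n2_neq0.
Qed.

Variables (t : 'I_n -> R) (S : tens3).
Hypothesis S12 : forall i j k, S i j k = S j i k.
Hypothesis S23 : forall i j k, S i j k = S i k j.
Hypothesis S_tr : forall k, tr (fun i j => S i j k) = 0.

Local Notation sq := (pscrS h S).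
Local Notation sg := (pcontr2 h t S).

Lemma pscrSC j k : sq j k = sq k j.
Proof.
rewrite /pscrS (mtrace_exchange h (fun i m l p => S i j p * S k l m)).
apply: eq_mtrace => i m; apply: eq_mtrace => l p.
by rewrite mulrC (S12 j) (S12 i k).
Qed.

Variable B : 'I_n -> 'I_n -> R.
Hypothesis BC : forall i j, B i j = B j i.

(** The component g(S_X S_Y Z, W) with X, Y, Z, W in the directions i, j, k, w. *)
Definition SS i w j k := tr (fun l p => S i l w * S j k p).

(** The tensor S_1 prescribing the derivative of S for n > 2, with its
coefficient of the metric left as an arbitrary symmetric form B. *)
Definition pS1 i j k w := SS i w j k + 3 * S i j w * t k + S i j k * t w
                          + B j k * g i w.

Lemma SSC i w j k : SS i w j k = SS i w k j.
Proof. by apply: eq_mtrace => l p; rewrite (S12 j). Qed.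

Lemma psym3_pS1 i j k w : psym3 (fun a b c => pS1 a b c w) i j k =
  3^-1 * (SS i w j k + SS j w i k + SS k w i j
          + 3 * (S i j w * t k + S i k w * t j + S j k w * t i)
          + 3 * (S i j k * t w)
          + (B j k * g i w + B i k * g j w + B i j * g k w)).
Proof.
rewrite /psym3 /pS1 (SSC i w k) (SSC j w k) (SSC k w j) (BC k j) (BC k i) (BC j i).
rewrite (S12 j i w) (S12 k i w) (S12 k j w).
have -> : S i k j = S i j k by rewrite S23.
have -> : S j i k = S i j k by rewrite S12.
have -> : S j k i = S i j k by rewrite S23 S12.
have -> : S k i j = S i j k by rewrite S12 S23.
have -> : S k j i = S i j k by rewrite S23 S12 S23.
by field.
Qed.

Lemma mtrace_psym3_pS1 k w : tr (fun a b => psym3 (fun a b c => pS1 a b c w) a b k) =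
  3^-1 * (2 * sq w k + 6 * sg w k + 2 * B w k + tr B * g k w).
Proof.
rewrite (eq_mtrace _ (fun i j => psym3_pS1 i j k w)) mtraceZ !mtraceD !mtraceZ !mtraceD.
have -> : tr (fun i j => SS i w j k) = sq w k.
  rewrite /pscrS -(mtrace_swap hC); apply: eq_mtrace => a b.
  by apply: eq_mtrace => l p; rewrite mulrC (S13 S12 S23 b).
have -> : tr (fun i j => SS j w i k) = sq w k.
  by apply: eq_mtrace => a b; apply: eq_mtrace => l p; rewrite mulrC (S13 S12 S23 b).
have -> : tr (fun i j => SS k w i j) = 0.
  rewrite mtrace_exchange -(mtrace0 h); apply: eq_mtrace => l p.
  by rewrite mtraceZ S_tr mulr0.
have -> : tr (fun i j => S i j w * t k) = 0 by rewrite mtraceZr S_tr mul0r.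
have -> : tr (fun i j => S i j k * t w) = 0 by rewrite mtraceZr S_tr mul0r.
have -> : tr (fun i j => S i k w * t j) = sg w k.
  by rewrite -(mtrace_swap hC); apply: eq_mtrace => i j; rewrite (S13 S12 S23).
have -> : tr (fun i j => S j k w * t i) = sg w k.
  by apply: eq_mtrace => i j; rewrite (S13 S12 S23).
have -> : tr (fun i j => B j k * g i w) = B w k.
  by rewrite -(mtrace_swap hC) (mtrace_gr hg (fun i => B i k)).
have -> : tr (fun i j => B i k * g j w) = B w k.
  by rewrite (mtrace_gr hg (fun i => B i k)).
rewrite mtraceZr; ring.
Qed.

(** The divergence contracts the direction of differentiation w with the first
index.  Symmetrisation turns S_1 into ten terms ([psym3_pS1]), and the removed traces contribute through
[mtrace_psym3_pS1]. *)
Lemma pdivS_pS1 DS :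
  (forall w i j k, DS w i j k = 3^-1 * psym30 (fun a b c => pS1 a b c w) i j k) ->
  forall j k, pdivS h DS j k =
    3^-1 * (3^-1 * (2 * sq j k + (n%:R + 2) * B j k) + 2 * sg j k
    - (n%:R + 2)^-1 * 3^-1 * (4 * sq j k + 12 * sg j k + 4 * B j k
        + (2 * tr sq + (n%:R + 2) * tr B + 2 * tr B) * g j k)).
Proof.
move=> E j k; rewrite /pdivS.
have E' w i : DS w i j k = 3^-1 * (3^-1 * (SS i w j k + SS j w i k + SS k w i j
          + 3 * (S i j w * t k + S i k w * t j + S j k w * t i)
          + 3 * (S i j k * t w)
          + (B j k * g i w + B i k * g j w + B i j * g k w))
   - (n%:R + 2)^-1 * (3^-1 * (
       (2 * (sq w k * g i j) + 6 * (sg w k * g i j)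
         + 2 * (B w k * g i j) + tr B * (g i j * g w k))
       + (2 * (sq w j * g i k) + 6 * (sg w j * g i k)
         + 2 * (B w j * g i k) + tr B * (g i k * g w j))
       + g j k * (2 * sq w i + 6 * sg w i + 2 * B w i + tr B * g w i)))).
  by rewrite E /psym30 /= psym3_pS1 !mtrace_psym3_pS1 (gC k w) (gC j w) (gC i w); ring.
rewrite (eq_mtrace _ E') mtraceZ mtraceB !(mtraceZ, mtraceD).
have -> : tr (fun i j0 => SS j0 i j k) = 0.
  rewrite mtrace_exchange -(mtrace0 h); apply: eq_mtrace => l p.
  rewrite mtraceZr; have -> : tr (fun i j0 => S j0 l i) = 0; last by rewrite mul0r.
  by rewrite -(mtrace_swap hC) (S_trace13 S23 S_tr).
have -> : tr (fun i j0 => SS j i j0 k) = sq j k.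
  rewrite /pscrS -(mtrace_swap hC); apply: eq_mtrace => a b.
  by apply: eq_mtrace => l p; rewrite mulrC.
have -> : tr (fun i j0 => SS k i j0 j) = sq j k.
  rewrite pscrSC /pscrS -(mtrace_swap hC); apply: eq_mtrace => a b.
  by apply: eq_mtrace => l p; rewrite mulrC.
have -> : tr (fun i j0 => S j0 j i * t k) = 0.
  by rewrite mtraceZr -(mtrace_swap hC) (S_trace13 S23 S_tr) mul0r.
have -> : tr (fun i j0 => S j0 k i * t j) = 0.
  by rewrite mtraceZr -(mtrace_swap hC) (S_trace13 S23 S_tr) mul0r.
have -> : tr (fun i j0 => S j k i * t j0) = sg j k by rewrite -(mtrace_swap hC).
have -> : tr (fun i j0 => S j0 j k * t i) = sg j k.
  by apply: eq_mtrace => a b; rewrite S12 S23.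
have -> : tr (fun i j0 => g j0 i) = n%:R by rewrite -(mtrace_swap hC) (mtrace_g gC hg).
have -> : tr (fun i j0 => B j0 k * g j i) = B j k.
  rewrite -(mtrace_swap hC) -[RHS](mtrace_gr hg (fun i => B i k)).
  by apply: eq_mtrace => a b; rewrite (gC j).
have -> : tr (fun i j0 => B j0 j * g k i) = B j k.
  rewrite BC -(mtrace_swap hC) -[RHS](mtrace_gr hg (fun i => B i j)).
  by apply: eq_mtrace => a b; rewrite (gC k).
have X (Y : 'I_n -> 'I_n -> R) (YC : forall a b, Y a b = Y b a) a b :
    tr (fun i j0 => Y i a * g j0 b) = Y b a.
  by rewrite (mtrace_gr hg (fun i => Y i a)).
have SC := pcontr2C h t S12.
rewrite !X // ?mtrace_pcontr2 //; try exact: pscrSC.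
have -> : tr (fun i j0 => g j0 j * g i k) = g j k.
  by rewrite -[RHS](mtrace_gl hC hg (fun a => g j a)); apply: eq_mtrace => a b; rewrite (gC b) mulrC.
have -> : tr (fun i j0 => g j0 k * g i j) = g j k.
  by rewrite gC -[RHS](mtrace_gl hC hg (fun a => g k a)); apply: eq_mtrace => a b; rewrite (gC b) mulrC.
have -> : tr (fun i j0 => g i j0) = n%:R by rewrite (mtrace_g gC hg).
rewrite (pscrSC k j) (BC k j) (SC k j).

rewrite ?mtrace_pcontr2 //; field; exact: n2_neq0.
Qed.

End Projection.

(** * Ricci-flatness in terms of trace-free and trace parts *)

Section RicciFlatness.
Context {R : realFieldType} {n : nat}.
Variables (g h : 'I_n -> 'I_n -> R).
Hypothesis gC : forall i j, g i j = g j i.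
Hypothesis hC : forall i j, h i j = h j i.
Hypothesis hg : forall i j, \sum_l h i l * g l j = (i == j)%:R.
Local Notation tr := (mtrace h).

Variables (t : 'I_n -> R) (S : 'I_n -> 'I_n -> 'I_n -> R).
Hypothesis S12 : forall i j k, S i j k = S j i k.
Hypothesis S23 : forall i j k, S i j k = S i k j.
Hypothesis S_tr : forall k, tr (fun i j => S i j k) = 0.

Local Notation sq := (pscrS h S).
Local Notation sg := (pcontr2 h t S).
Local Notation nt := (pnorm2 h t).
Local Notation N := (tr sq).

Definition ptracefree (b : 'I_n -> 'I_n -> R) i j := b i j - n%:R^-1 * tr b * g i j.

Lemma eq_ptracefree b c i j : (forall k l, b k l = c k l) -> ptracefree b i j = ptracefree c i j.
Proof. by move=> bc; rewrite /ptracefree bc (eq_mtrace h bc). Qed.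

Lemma mtrace_ptracefree b : (0 < n)%N -> tr (ptracefree b) = 0.
Proof.
move=> n0; rewrite /ptracefree mtraceB mtraceZ (mtrace_g gC hg); field.
by rewrite pnatr_eq0 -lt0n.
Qed.

Lemma mtrace_tt : tr (fun i j => t i * t j) = nt.
Proof. by []. Qed.

Variables (DS : 'I_n -> 'I_n -> 'I_n -> 'I_n -> R) (H : 'I_n -> 'I_n -> R).
Variable (Rc : 'I_n -> 'I_n -> R).

(** The Ricci tensor of the connection whose difference from the Levi-Civita
connection is the cubic, as computed in [mtrace_curv_pcubic]; Rc stands for the
Ricci tensor of g. *)
Definition pricci j k :=
  Rc j k + (3^-1 * (pdivS h DS j k - n%:R * H j k + tr H * g j k)
  + (n%:R + 2) / 9 * (sg j k + 2 * (t j * t k) + nt * g j k)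
  - 9^-1 * (sq j k + 4 * sg j k + (n%:R + 6) * (t j * t k) + 2 * nt * g j k)).

Section Ge3.
Hypothesis n3 : (3 <= n)%N.

Let P i j := (n%:R - 2)^-1 * (Rc i j - tr Rc / (2 * (n%:R - 1)) * g i j).
Let B j k := 4 / (n%:R - 2) * sq j k - 3 * sg j k.

Hypothesis HE : forall i j, H i j = 3 * P i j
  + 3^-1 * (t i * t j - 2^-1 * nt * g i j)
  + (3 * (n%:R - 2))^-1 *
    (sq i j + (n%:R - 6) * N / (2 * (n%:R - 1) * (n%:R + 2)) * g i j).
Hypothesis DSE : forall w i j k,
  DS w i j k = 3^-1 * psym30 g h (fun a b c => pS1 g h t S B a b c w) i j k.

Let tau i j := 2 / (3 * (n%:R - 2)) * ptracefree sq i j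
  - 2 / 3 * ptracefree (fun a b => sg a b + t a * t b) i j + 2 * ptracefree P i j.

Let nR0 : n%:R != 0 :> R.
Proof. by rewrite pnatr_eq0 -lt0n; case: n n3. Qed.
Let nR1 : n%:R - 1 != 0 :> R.
Proof. by rewrite subr_eq0 pnatr_eq1; case: n n3 => [|[]]. Qed.
Let nR2 : n%:R - 2 != 0 :> R.
Proof. by rewrite subr_eq0 eqr_nat; case: n n3 => [|[|[]]]. Qed.
Let nR2' : n%:R + 2 != 0 :> R.
Proof. exact: n2_neq0. Qed.

(** With B = 4 / (n - 2) Q - 3 S(grad t), where Q = tr (S_X S_Y), the coefficients simplify: those of
n + 2 cancel. *)
Lemma pdivS_ge3 j k : pdivS h DS j k =
  2 * n%:R / (3 * (n%:R - 2)) * ptracefree sq j k - n%:R / 3 * sg j k.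
Proof.
have BC a b : B a b = B b a by rewrite /B (pscrSC _ S12) (pcontr2C _ _ S12).
rewrite (pdivS_pS1 gC hC hg S12 S23 S_tr BC DSE).
have -> : tr B = 4 / (n%:R - 2) * N.
  rewrite /B mtraceB (mtraceZ _ _ sq) (mtraceZ _ _ sg) (mtrace_pcontr2 _ S_tr); ring.
rewrite /B /ptracefree; field; rewrite ?nR0 ?nR1 ?nR2 ?nR2' //.
Qed.

(** The decomposition into trace-free and trace parts.  The Hessian brings in
-n P_o, against (n - 2) P_o from Ric(g), which leaves -2 P_o = (2 - 8) / 3 P_o. *)
Lemma pricci_ge3 j k : pricci j k = 3^-1 * tau j k - 8 / 3 * ptracefree P j k
  + n%:R^-1 * (tr Rc - 9^-1 * (N - (n%:R - 1) * (n%:R + 2) * nt)) * g j k.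
Proof.
have trP : tr P = tr Rc / (2 * (n%:R - 1)).
  by rewrite /P mtraceZ mtraceB mtraceZ (mtrace_g gC hg); field; rewrite nR1 nR2.
have trH : tr H = 3 * (tr Rc / (2 * (n%:R - 1)))
  + 3^-1 * (nt - 2^-1 * nt * n%:R)
  + (3 * (n%:R - 2))^-1 *
    (N + (n%:R - 6) * N / (2 * (n%:R - 1) * (n%:R + 2)) * n%:R).
  rewrite (eq_mtrace h HE) !mtraceD (mtraceZ _ _ P) trP !mtraceZ mtraceB mtraceD !mtraceZ (mtrace_g gC hg) //.
have trst : tr (fun a b => sg a b + t a * t b) = nt.
  by rewrite mtraceD (mtrace_pcontr2 _ S_tr) add0r.
rewrite /pricci pdivS_ge3 trH HE /tau /ptracefree trst trP /P.
field; rewrite ?nR0 ?nR1 ?nR2 ?nR2' //.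
Qed.

Lemma pricci_eq0_ge3 : (forall j k, pricci j k = 0) <->
  (forall i j, ptracefree P i j = 8^-1 * tau i j) /\
  tr Rc = 9^-1 * (N - (n%:R - 1) * (n%:R + 2) * nt).
Proof.
set s := 9^-1 * _; split=> [R0|[PE sE] j k]; last first.
  by rewrite pricci_ge3 -/s sE PE; field.
have n0 : (0 < n)%N by case: n n3.
have sE : tr Rc = s.
  apply/subr0_eq; rewrite -(mtrace0 h) -(eq_mtrace h R0) (eq_mtrace h pricci_ge3).
  rewrite mtraceD mtraceB !mtraceZ (mtrace_g gC hg) /tau mtraceD mtraceB.
  rewrite (mtraceZ _ _ (ptracefree sq)) (mtraceZ _ _ (ptracefree P)).
  rewrite (mtraceZ _ _ (ptracefree (fun a b => sg a b + t a * t b))).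
  by rewrite !mtrace_ptracefree // -/s; field; rewrite nR0 nR2.
split=> // i j; have := R0 i j; rewrite pricci_ge3 -/s sE subrr mulr0 mul0r addr0.
move=> E; have -> : tau i j = 3 * (3^-1 * tau i j - 8 / 3 * ptracefree P i j) + 8 * ptracefree P i j.
  by field.
by rewrite E; field.
Qed.

End Ge3.

Section Dim2.
Hypothesis n2 : n = 2%N.
Hypothesis scr_tf : forall i j, sq i j = 2^-1 * N * g i j.
Hypothesis Rc_tf : forall i j, Rc i j = 2^-1 * tr Rc * g i j.
Hypothesis tr_divS0 : tr (pdivS h DS) = 0.

Let E i j := pdivS h DS i j + 2 / 3 * sg i j.
Let tau i j := 2 / 3 * H i j - 2 / 3 * sg i j + 3^-1 * E i j
  - 8 / 9 * (t i * t j - 2^-1 * nt * g i j) - 9^-1 * N * g i j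
  - 2^-1 * tr Rc * g i j.

(** The vanishing trace of tau expresses the Laplacian of t through Scal and
|S|^2; this removes it from the Ricci tensor. *)
Lemma pricci_eq0_2 : tr tau = 0 -> ((forall j k, pricci j k = 0) <->
  tr Rc = 9^-1 * (N - 4 * nt) /\
  forall i j, tau i j = 2 / 3 * E i j
     - 8 / 9 * (sg i j + t i * t j - 2^-1 * nt * g i j)).
Proof.
have nE : n%:R = 2 :> R by rewrite n2.
have trE : tr E = 0.
  by rewrite /E mtraceD tr_divS0 (mtraceZ _ _ sg) (mtrace_pcontr2 _ S_tr) mulr0 addr0.
move=> tau0; have : tr tau = 2 / 3 * tr H - 2 / 9 * N - tr Rc.
  rewrite /tau !mtraceB mtraceD mtraceB (mtraceZ _ _ E) trE (mtraceZ _ _ sg) (mtrace_pcontr2 _ S_tr).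
  rewrite (mtraceZ _ _ H) mtraceZ mtraceB !mtraceZ (mtrace_g gC hg) nE mtrace_tt; by field.
rewrite tau0 => tH0.
have tH : tr H = 3 / 2 * (2 / 9 * N + tr Rc).
  have -> : 2 / 9 * N + tr Rc = 2 / 3 * tr H by lra.
  by field.
pose s := tr Rc - 9^-1 * (N - 4 * nt).
have RE j k : pricci j k = 2 / 3 * E j k
     - 8 / 9 * (sg j k + t j * t k - 2^-1 * nt * g j k) - tau j k
     + 2^-1 * s * g j k.
  by rewrite /pricci /tau tH scr_tf Rc_tf /s /E nE; field.
split=> [R0|[sE tE] j k]; last first.
  by rewrite RE tE subrr add0r /s sE subrr mulr0 mul0r.
have s0 : s = 0.
  have := eq_mtrace h R0; rewrite mtrace0 (eq_mtrace h RE) mtraceD mtraceB mtraceB (mtraceZ _ _ E) trE.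
  rewrite tau0 !mtraceZ mtraceB !mtraceD (mtrace_pcontr2 _ S_tr) !mtraceZ (mtrace_g gC hg) nE mtrace_tt.
  by move=> <-; field.
split=> [|i j].
  by apply/subr0_eq; exact: s0.
have := R0 i j; rewrite RE s0 mulr0 mul0r addr0 => /subr0_eq ->.
by [].
Qed.

End Dim2.
End RicciFlatness.

(** * Algebra in dimension two *)

Section Surface.
Context {R : realFieldType}.
Variables (g h : 'I_2 -> 'I_2 -> R).
Hypothesis gC : forall i j, g i j = g j i.
Hypothesis hC : forall i j, h i j = h j i.
Hypothesis hg : forall i j, \sum_l h i l * g l j = (i == j)%:R.
Local Notation tr := (mtrace h).

Lemma ord2P (i : 'I_2) : i = 0 \/ i = 1.
Proof. by case: i => [[|[]]] //= p; [left|right]; apply/val_inj. Qed.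

Lemma sum2 (F : 'I_2 -> R) : \sum_i F i = F 0 + F 1.
Proof.
by rewrite !big_ord_recl big_ord0 addr0; congr (F _ + F _); apply/val_inj.
Qed.

Lemma mtrace2 b : tr b = h 0 0 * b 0 0 + h 0 1 * (b 0 1 + b 1 0) + h 1 1 * b 1 1.
Proof. by rewrite /mtrace !sum2 (hC 1 0); ring. Qed.

(** The polarised Cayley-Hamilton identity MN + NM = tr (MN) for trace-free
2 x 2 matrices. *)
Lemma cayley_hamilton2 (M N : 'I_2 -> 'I_2 -> R) i j :
  \sum_k M k k = 0 -> \sum_k N k k = 0 ->
  \sum_k (M i k * N k j + N i k * M k j) = (i == j)%:R * \sum_a \sum_b M a b * N b a.
Proof.
rewrite !sum2 => /eqP; rewrite addrC addr_eq0 => /eqP EM /eqP.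
rewrite addrC addr_eq0 => /eqP EN.
by case: (ord2P i) => ->; case: (ord2P j) => ->; rewrite /= EM EN; ring.
Qed.

(** The endomorphisms S_X are trace-free, so S_X S_Y + S_Y S_X = tr (S_X S_Y).
Tracing this over X and Y yields 2 tr (S_Z S_W) = |S|^2 g(Z, W). *)
Lemma pscrS_ord2 (S : 'I_2 -> 'I_2 -> 'I_2 -> R) :
  (forall i j k, S i j k = S j i k) -> (forall i j k, S i j k = S i k j) ->
  (forall k, tr (fun i j => S i j k) = 0) ->
  forall i j, pscrS h S i j = 2^-1 * tr (pscrS h S) * g i j.
Proof.
move=> S12 S23 S_tr m j.
pose A p k l := \sum_a h k a * S p l a.
have A0 p : \sum_k A p k k = 0.
  rewrite -[RHS](S_tr p) /A /mtrace; apply: eq_bigr => i _; apply: eq_bigr => k _.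
  by rewrite (S12 p) (S23 i).
have scrA p q : \sum_a \sum_b A p a b * A q b a = pscrS h S p q by exact: pscrS_hat.
have lowA p k l : \sum_i g i l * A p i k = S p k l.
  under eq_bigr => i _ do rewrite mulr_sumr.
  rewrite exchange_big /= -[RHS](sum_delta (fun a => S p k a)).
  apply: eq_bigr => a _; rewrite -hg mulr_suml; apply: eq_bigr => i _.
  by rewrite (hC a); ring.
have CH p q k l :
    \sum_a (S p a l * A q a k + S q a l * A p a k) = pscrS h S p q * g k l.
  transitivity (\sum_i g i l * \sum_a (A p i a * A q a k + A q i a * A p a k)).
    under [RHS]eq_bigr => i _ do rewrite mulr_sumr.
    rewrite exchange_big; apply: eq_bigr => a _ /=.
    rewrite -!lowA !mulr_suml -big_split; apply: eq_bigr => i _ /=; ring.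
  under eq_bigr => i _ do rewrite cayley_hamilton2 // scrA mulrCA.
  by rewrite sum_delta mulrC.
have S13' := S13 S12 S23.
have SA u v : tr (fun p q => \sum_a S p a u * A q a v) = pscrS h S u v.
  rewrite /pscrS -[RHS](mtrace_swap hC); apply: eq_mtrace => p q; apply: eq_bigr => a _.
  rewrite mulr_sumr; apply: eq_bigr => b _; rewrite (S13' p); ring.
have H : tr (fun p q => \sum_a (S p a m * A q a j + S q a m * A p a j))
    = pscrS h S m j + pscrS h S m j.
  rewrite -{1}SA -(SA m j) -[X in _ = _ + X](mtrace_swap hC) -mtraceD.
  by apply: eq_mtrace => p q; rewrite big_split.
rewrite (eq_mtrace h (fun p q => CH p q j m)) mtraceZr gC in H.
have -> : pscrS h S m j = 2^-1 * (pscrS h S m j + pscrS h S m j) by field.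
by rewrite -H mulrA.
Qed.

(** In dimension two a curvature tensor has a single component r, so its Ricci
contraction is r times the cofactor matrix of h, and this is det h times g. *)
Lemma ricci_ord2 (Rl : 'I_2 -> 'I_2 -> 'I_2 -> 'I_2 -> R) :
  (forall m k i j, Rl m k i j = - Rl k m i j) ->
  (forall m k i j, Rl m k i j = - Rl m k j i) ->
  let Rc j k := tr (fun i m => Rl m k i j) in
  forall j k, Rc j k = 2^-1 * tr Rc * g j k.
Proof.
move=> a1 a2 Rc.
have z1 m i j : Rl m m i j = 0 by have := a1 m m i j; lra.
have z2 m k i : Rl m k i i = 0 by have := a2 m k i i; lra.
pose r := Rl 0 1 0 1.
have r1 : Rl 1 0 0 1 = - r by rewrite a1.
have r2 : Rl 0 1 1 0 = - r by rewrite a2.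
have r3 : Rl 1 0 1 0 = r by rewrite a1 a2 opprK.
have R00 : Rc 0 0 = h 1 1 * r by rewrite /Rc mtrace2 !(z1, z2) r3; ring.
have R01 : Rc 0 1 = - h 0 1 * r by rewrite /Rc mtrace2 !(z1, z2) r2; ring.
have R10 : Rc 1 0 = - h 0 1 * r by rewrite /Rc mtrace2 !(z1, z2) r1; ring.
have R11 : Rc 1 1 = h 0 0 * r by rewrite /Rc mtrace2 !(z1, z2) -/r; ring.
have := (hg 0 0, hg 0 1, hg 1 0, hg 1 1); rewrite !sum2 /= (hC 1 0) (gC 1 0).
move=> [[[e00 e01] e10] e11].
set d := h 0 0 * h 1 1 - h 0 1 * h 0 1.
have g00 : d * g 0 0 = h 1 1.
  transitivity (h 1 1 * (h 0 0 * g 0 0 + h 0 1 * g 0 1)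
                - h 0 1 * (h 0 1 * g 0 0 + h 1 1 * g 0 1)); first by rewrite /d; ring.
  by rewrite e00 e10; ring.
have g01 : d * g 0 1 = - h 0 1.
  transitivity (h 0 0 * (h 0 1 * g 0 0 + h 1 1 * g 0 1)
                - h 0 1 * (h 0 0 * g 0 0 + h 0 1 * g 0 1)); first by rewrite /d; ring.
  by rewrite e00 e10; ring.
have g11 : d * g 1 1 = h 0 0.
  transitivity (h 0 0 * (h 0 1 * g 0 1 + h 1 1 * g 1 1)
                - h 0 1 * (h 0 0 * g 0 1 + h 0 1 * g 1 1)); first by rewrite /d; ring.
  by rewrite e11 e01; ring.
have T : 2^-1 * tr Rc = d * r.
  by rewrite mtrace2 R00 R01 R10 R11 /d; field.
move=> j k; rewrite T mulrAC.
case: (ord2P j) => ->; case: (ord2P k) => ->.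
- by rewrite g00.
- by rewrite g01.
- by rewrite (gC 1 0) g01.
- by rewrite g11.
Qed.

End Surface.

Section SurfaceN.
Context {R : realFieldType} {n : nat}.
Variables (g h : 'I_n -> 'I_n -> R).
Hypothesis n2 : n = 2%N.
Hypothesis gC : forall i j, g i j = g j i.
Hypothesis hC : forall i j, h i j = h j i.
Hypothesis hg : forall i j, \sum_l h i l * g l j = (i == j)%:R.

Lemma pscrS_surface (S : 'I_n -> 'I_n -> 'I_n -> R) :
  (forall i j k, S i j k = S j i k) -> (forall i j k, S i j k = S i k j) ->
  (forall k, mtrace h (fun i j => S i j k) = 0) ->
  forall i j, pscrS h S i j = 2^-1 * mtrace h (pscrS h S) * g i j.
Proof. by subst n; exact: pscrS_ord2. Qed.

Lemma ricci_surface (Rl : 'I_n -> 'I_n -> 'I_n -> 'I_n -> R) :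
  (forall m k i j, Rl m k i j = - Rl k m i j) ->
  (forall m k i j, Rl m k i j = - Rl m k j i) ->
  let Rc j k := mtrace h (fun i m => Rl m k i j) in
  forall j k, Rc j k = 2^-1 * mtrace h Rc * g j k.
Proof. by subst n; exact: ricci_ord2. Qed.

End SurfaceN.

(** * Curvature of a connection and of the Levi-Civita connection *)

Section CurvatureAlgebra.
Context {R : comRingType} {n : nat}.
Local Notation I := 'I_n.
Variables (g : I -> I -> R) (G : I -> I -> I -> R) (dg : I -> I -> I -> R).
Hypothesis dgE : forall i l m,
  dg i l m = \sum_p G p i l * g p m + \sum_p G p i m * g l p.

(** The lowered curvature is the antisymmetrisation of this expression in i and
j ([riem_half_curv]); working before antisymmetrisation halves every
computation. *)
Definition half_curv (G : I -> I -> I -> R) (dG : I -> I -> I -> I -> R) m k i j :=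
  \sum_l g l m * (dG i l j k + \sum_p G l i p * G p j k).

(** Lowering the index before differentiating replaces the derivative of K by
that of C, at the cost of the derivative of g; the latter is converted by
[dgE], and one of its two terms cancels the mixed product G K. *)
Lemma half_curv_change (K : I -> I -> I -> R) (dG dK : I -> I -> I -> I -> R)
    (C : I -> I -> I -> R) m k i j :
  (forall i j m, C i j m = \sum_l g l m * K l i j) ->
  half_curv (fun l i j => G l i j + K l i j)
        (fun i l j k => dG i l j k + dK i l j k) m k i j =
  half_curv G dG m k i j
  + (\sum_l (dg i l m * K l j k + g l m * dK i l j k)
     - \sum_p G p i m * C j k p + \sum_p G p j k * C i p m)
  + \sum_p K p j k * C i p m.
Proof.
move=> CE.
have e1 : \sum_l dg i l m * K l j k =
    \sum_l g l m * (\sum_p G l i p * K p j k) + \sum_p G p i m * C j k p.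
  under eq_bigr => l _ do rewrite dgE mulrDl !mulr_suml.
  rewrite big_split; congr (_ + _).
    rewrite exchange_big; apply: eq_bigr => l _; rewrite mulr_sumr.
    by apply: eq_bigr => p _; ring.
  rewrite exchange_big; apply: eq_bigr => l _; rewrite CE mulr_sumr.
  by apply: eq_bigr => p _; ring.
have e2 (X : I -> R) : \sum_p X p * C i p m = \sum_l g l m * \sum_p K l i p * X p.
  under eq_bigr => p _ do rewrite CE mulr_sumr.
  rewrite exchange_big; apply: eq_bigr => l _; rewrite mulr_sumr.
  by apply: eq_bigr => p _; ring.
rewrite big_split /= e1 !e2 /half_curv.
have gen (a b c d e q : R) : a + (b + c + d - c + e) + q = a + b + d + e + q by ring.
rewrite gen.
rewrite -!big_split; apply: eq_bigr => l _ /=.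
rewrite -!mulrDr; congr (_ * _).
have -> : \sum_p (G l i p + K l i p) * (G p j k + K p j k) =
   \sum_p G l i p * G p j k + \sum_p G l i p * K p j k
   + \sum_p K l i p * G p j k + \sum_p K l i p * K p j k.
  by rewrite -!big_split; apply: eq_bigr => p _ /=; ring.
ring.
Qed.

(** The left-hand side is the first half of the second derivative of g.  The
extra double sum is unchanged when i, j and k, m are exchanged simultaneously. *)
Lemma half_curv_metric dG m k i j : (forall i j, g i j = g j i) ->
  \sum_p (dG i p j k * g p m + G p j k * dg i p m) =
  half_curv G dG m k i j + \sum_p \sum_q G p j k * (G q i m * g p q).
Proof.
move=> gC; rewrite big_split /= /half_curv.
have -> : \sum_p G p j k * dg i p m = \sum_l g l m * (\sum_p G l i p * G p j k)
    + \sum_p \sum_q G p j k * (G q i m * g p q).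
  under eq_bigr => l _ do rewrite dgE mulrDr !mulr_sumr.
  rewrite big_split; congr (_ + _).
  rewrite exchange_big; apply: eq_bigr => l _; rewrite mulr_sumr.
  by apply: eq_bigr => p _; ring.
by rewrite addrA -big_split /=; congr (_ + _); apply: eq_bigr => l _; ring.
Qed.

End CurvatureAlgebra.

Section LeviCivita.
Context {R : realType} {n : nat}.
Variables (U : set 'rV[R]_n) (g : 'I_n -> 'I_n -> 'rV[R]_n -> R).
Hypothesis oU : open U.
Hypothesis g_smooth : forall i j, smooth_on U (g i j).
Hypothesis gC : forall x, U x -> forall i j, g i j x = g j i x.
Hypothesis gU : forall x, U x -> metric_mx g x \in unitmx.

Local Notation LC := (levi_civita g).

Lemma ginv_mul x : U x ->
  forall i j, \sum_l ginv g i l x * g l j x = (i == j)%:R.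
Proof.
move=> Ux i j; have := mulVmx (gU Ux) => /matrixP/(_ i j); rewrite !mxE => <-.
by apply: eq_bigr => l _; rewrite [metric_mx g x l j]mxE.
Qed.

Lemma ginvC x : U x -> forall i j, ginv g i j x = ginv g j i x.
Proof.
move=> Ux i j; have gT : (metric_mx g x)^T = metric_mx g x.
  by apply/matrixP => k l; rewrite !mxE gC.
by rewrite /ginv -{1}gT -trmx_inv mxE.
Qed.

Lemma pder_gC x i j k : U x -> pder k (g i j) x = pder k (g j i) x.
Proof. by move=> Ux; apply: (pder_eq_on _ oU Ux) => y Uy; exact: gC. Qed.

Lemma LC_C x : U x -> forall k i j, LC k i j x = LC k j i x.
Proof.
move=> Ux k i j; rewrite /levi_civita; congr (_ * _); apply: eq_bigr => l _.
by rewrite (pder_gC i j _ Ux) [pder i _ x + _]addrC.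
Qed.

Lemma LC_lower x : U x -> forall m i j, \sum_l LC l i j x * g l m x =
  2^-1 * (pder i (g j m) x + pder j (g i m) x - pder m (g i j) x).
Proof.
move=> Ux m i j; rewrite /levi_civita.
under eq_bigr => l _ do rewrite -mulrA mulr_suml.
rewrite -mulr_sumr; congr (_ * _); rewrite exchange_big /=.
rewrite -[RHS](sum_delta (fun l => pder i (g j l) x + pder j (g i l) x - pder l (g i j) x)).
apply: eq_bigr => l _; rewrite -(ginv_mul Ux) mulr_suml; apply: eq_bigr => k _.
by rewrite (ginvC Ux l); ring.
Qed.

Lemma LC_metric x : U x -> forall i l m, pder i (g l m) x =
  \sum_p LC p i l x * g p m x + \sum_p LC p i m x * g l p x.
Proof.
move=> Ux i l m.
have -> : \sum_p LC p i m x * g l p x = \sum_p LC p i m x * g p l x.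
  by apply: eq_bigr => p _; rewrite (gC Ux l).
rewrite !(LC_lower Ux) (pder_gC m l _ Ux) (pder_gC i m _ Ux) (pder_gC i l _ Ux).
by field.
Qed.

Lemma pderivable_g x i j : U x -> pderivable (g i j) x.
Proof.
by move=> Ux; apply: differentiable_pderivable; exact: smooth_on_differentiable Ux.
Qed.

Lemma pderivable_ginv x i j : U x -> pderivable (ginv g i j) x.
Proof.
move=> Ux; apply: (@pderivable_invmx _ _ _ (metric_mx g) _ _ _ _ oU Ux gU) => k l.
by under eq_fun do rewrite mxE; exact: pderivable_g.
Qed.

Lemma pderivable_LC x k i j : U x -> pderivable (LC k i j) x.
Proof.
move=> Ux; apply: pderivableM; first exact: pderivable_cst.
apply: pderivable_sum => l; apply: pderivableM; first exact: pderivable_ginv.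
have dp a b c : pderivable (pder a (g b c)) x.
  apply: differentiable_pderivable; apply: smooth_on_differentiable Ux.
  exact: smooth_on_pder.
by apply: pderivableB => //; exact: pderivableD.
Qed.

Lemma riem_swap (Gam : 'I_n -> 'I_n -> 'I_n -> 'rV[R]_n -> R) l k i j x :
  riem Gam l k i j x = - riem Gam l k j i x.
Proof. by rewrite /riem !sumrB [RHS]opprD !opprB. Qed.

Lemma riem_half_curv (Gam : 'I_n -> 'I_n -> 'I_n -> 'rV[R]_n -> R) x m k i j :
  \sum_l g l m x * riem Gam l k i j x =
  half_curv (fun a b => g a b x) (fun a b c => Gam a b c x)
        (fun a b c d => pder a (Gam b c d) x) m k i j
  - half_curv (fun a b => g a b x) (fun a b c => Gam a b c x)
        (fun a b c d => pder a (Gam b c d) x) m k j i.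
Proof.
rewrite /half_curv -sumrB; apply: eq_bigr => l _; rewrite -mulrBr /riem sumrB.
by congr (_ * _); ring.
Qed.

Let antisym_cancel (a1 a2 b1 b2 u v : R) :
  a1 + u + (b1 + v) = a2 + v + (b2 + u) -> a1 - a2 = - (b1 - b2).
Proof. by move=> ?; lra. Qed.

(** Differentiating the compatibility of the connection with g once more, the
symmetry of the second derivatives of g_km leaves exactly the part of the
curvature that is symmetric in k and m. *)
Lemma riem_LC_antisym x m k i j : U x ->
  \sum_l g l m x * riem LC l k i j x = - \sum_l g l k x * riem LC l m i j x.
Proof.
move=> Ux; rewrite !riem_half_curv.
set gx := (fun a b => g a b x); set Gx := (fun a b c => LC a b c x).
set dG := (fun a b c d => pder a (LC b c d) x).
pose W m k i j := \sum_p \sum_q Gx p j k * (Gx q i m * gx p q).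
have WC a b : W m k a b = W k m b a.
  rewrite /W exchange_big; apply: eq_bigr => p _; apply: eq_bigr => q _.
  by rewrite /gx (gC Ux p q); ring.
have Z a b : pder a (pder b (g k m)) x =
    half_curv gx Gx dG m k a b + W m k a b + (half_curv gx Gx dG k m a b + W k m a b).
  rewrite (pder_eq_on a oU Ux (fun y Uy => LC_metric Uy b k m)).
  have dL p b' k' : pderivable (LC p b' k') x by exact: pderivable_LC.
  have dg p q : pderivable (g p q) x by exact: pderivable_g.
  rewrite pderD; try by apply: pderivable_sum => p; apply: pderivableM.
  rewrite !pder_sum; try by move=> p; apply: pderivableM.
  rewrite -!(@half_curv_metric _ _ gx Gx (fun i l m => pder i (g l m) x)) //;
    try exact: LC_metric; try exact: gC.
  congr (_ + _); apply: eq_bigr => p _; rewrite pderM //.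
  by rewrite /gx (gC Ux k p) (pder_gC k p _ Ux).
have := pderC i j oU Ux (g_smooth k m); rewrite !Z (WC i j) (WC j i) => E.
exact: antisym_cancel E.
Qed.

(** The curvature of nabla = nabla^g + K in terms of the covariant derivative of
the lowered difference C: torsion-freeness of nabla^g cancels the terms in which
the two directions of differentiation meet. *)
Lemma riem_change (Gam : 'I_n -> 'I_n -> 'I_n -> 'rV[R]_n -> R)
    (C : 'I_n -> 'I_n -> 'I_n -> 'rV[R]_n -> R) x m k i j : U x ->
  (forall a b c, pderivable (Gam a b c) x) ->
  (forall y, U y -> forall a b c,
     C a b c y = \sum_l g l c y * (Gam l a b y - LC l a b y)) ->
  \sum_l g l m x * riem Gam l k i j x =
  \sum_l g l m x * riem LC l k i j x
  + (cov3 LC C i j k m x - cov3 LC C j i k m x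
     + (\sum_l (Gam l j k x - LC l j k x) * C i l m x
        - \sum_l (Gam l i k x - LC l i k x) * C j l m x)).
Proof.
move=> Ux dGam CE.
have dL p b' k' : pderivable (LC p b' k') x by exact: pderivable_LC.
have dg p q : pderivable (g p q) x by exact: pderivable_g.
pose K a b c y := Gam a b c y - LC a b c y.
have GE : forall a b c y, Gam a b c y = LC a b c y + K a b c y.
  by move=> a b c y; rewrite /K addrC subrK.
have dK a b c : pderivable (K a b c) x by exact: pderivableB.
have dC a b c d : pder a (C b c d) x =
    \sum_l (pder a (g l d) x * K l b c x + g l d x * pder a (K l b c) x).
  rewrite (pder_eq_on a oU Ux (fun y Uy => CE y Uy b c d)).
  rewrite pder_sum; last by move=> l; apply: pderivableM => //; exact: dK.
  by apply: eq_bigr => l _; rewrite pderM //; exact: dK.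
have E a b : half_curv (fun a b => g a b x) (fun a b c => Gam a b c x)
        (fun a b c d => pder a (Gam b c d) x) m k a b =
     half_curv (fun a b => g a b x) (fun a b c => LC a b c x)
        (fun a b c d => pder a (LC b c d) x) m k a b
    + (pder a (C b k m) x - \sum_p LC p a m x * C b k p x
       + \sum_p LC p b k x * C a p m x)
    + \sum_p K p b k x * C a p m x.
  have CK i' j' m' : C i' j' m' x = \sum_l g l m' x * K l i' j' x by exact: CE.
  have := half_curv_change (LC_metric Ux) (fun i l j k => pder i (LC l j k) x)
    (fun i l j k => pder i (K l j k) x) m k a b CK.
  rewrite dC => <-.
  apply: eq_bigr => l _; congr (_ * (_ + _)).
    rewrite -pderD //; congr (pder _ _ _); apply/funext => y; exact: GE.
  by apply: eq_bigr => p _; rewrite -!GE.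
rewrite !riem_half_curv !E /cov3.
have -> : \sum_l LC l j i x * C l k m x = \sum_l LC l i j x * C l k m x.
  by apply: eq_bigr => l _; rewrite (LC_C Ux).
rewrite /K; ring.
Qed.

End LeviCivita.

(** * The Ricci tensor of a connection with prescribed cubic *)

Section ChartRicci.
Context {R : realType} {n : nat}.
Variables (U : set 'rV[R]_n) (g : 'I_n -> 'I_n -> 'rV[R]_n -> R).
Hypothesis oU : open U.
Hypothesis g_smooth : forall i j, smooth_on U (g i j).
Hypothesis gC : forall x, U x -> forall i j, g i j x = g j i x.
Hypothesis gU : forall x, U x -> metric_mx g x \in unitmx.

Local Notation LC := (levi_civita g).

Variables (S : 'I_n -> 'I_n -> 'I_n -> 'rV[R]_n -> R) (u : 'rV[R]_n -> R).
Hypothesis S_smooth : forall i j k, smooth_on U (S i j k).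
Hypothesis u_smooth : smooth_on U u.
Hypothesis S12 : forall x, U x -> forall i j k, S i j k x = S j i k x.
Hypothesis S23 : forall x, U x -> forall i j k, S i j k x = S i k j x.
Hypothesis S_tr : forall x, U x -> forall k, trg g (fun i j => S i j k) x = 0.

(** The cubic of the associated normalisation in the coordinates of a chart. *)
Definition cubic_field i j k y := pcubic (fun a b => g a b y)
  (fun a => dfun u a y) (fun a b c => S a b c y) i j k.

Section AtPoint.
Variable x : 'rV[R]_n.
Hypothesis Ux : U x.

Let gx i j := g i j x.
Let hx i j := ginv g i j x.
Let Sx i j k := S i j k x.
Let tx i := dfun u i x.
Let DS w i j k := cov3 LC S w i j k x.
Let Hx i j := hess LC u i j x.
Let Rc i j := Ric g i j x.

Let gxC i j : gx i j = gx j i. Proof. exact: gC. Qed.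
Let hxC i j : hx i j = hx j i. Proof. exact: (ginvC gC Ux). Qed.
Let hgx i j : \sum_l hx i l * gx l j = (i == j)%:R.
Proof. exact: (ginv_mul gU Ux). Qed.
Let Sx12 i j k : Sx i j k = Sx j i k. Proof. exact: S12. Qed.
Let Sx23 i j k : Sx i j k = Sx i k j. Proof. exact: S23. Qed.
Let Sx_tr k : mtrace hx (fun i j => Sx i j k) = 0. Proof. exact: S_tr. Qed.

Lemma hessC i j : hess LC u i j x = hess LC u j i x.
Proof.
rewrite /hess /cov1 /dfun (pderC i j oU Ux u_smooth); congr (_ - _).
by apply: eq_bigr => k _; rewrite (LC_C oU gC Ux).
Qed.

Lemma cov3_pcubic w i j k :
  cov3 LC cubic_field w i j k x = pcov_cubic gx DS Hx w i j k.
Proof.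
have dS a b c : pderivable (S a b c) x.
  by apply: differentiable_pderivable; exact: smooth_on_differentiable Ux.
have dg a b : pderivable (g a b) x by exact: pderivable_g.
have du a : pderivable (dfun u a) x.
  apply: differentiable_pderivable; apply: smooth_on_differentiable Ux.
  exact: smooth_on_pder.
have dug a b c : pderivable (fun y => dfun u a y * g b c y) x.
  by exact: pderivableM.
have dC : pder w (cubic_field i j k) x =
   3^-1 * (pder w (S i j k) x
     + (pder w (dfun u i) x * g j k x + dfun u i x * pder w (g j k) x)
     + (pder w (dfun u j) x * g i k x + dfun u j x * pder w (g i k) x)
     + (pder w (dfun u k) x * g i j x + dfun u k x * pder w (g i j) x)).
  have P a b c := pderM w (du a) (dg b c); rewrite -!P.
  have D1 := pderivableD (dS i j k) (dug i j k).
  have D2 := pderivableD D1 (dug j i k).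
  have D3 := pderivableD D2 (dug k i j).
  have := pderM w (@pderivable_cst R n R (3^-1) x) D3.
  rewrite pder_cst mul0r add0r => ->; congr (_ * _).
  by rewrite (pderD w D2 (dug k i j)) (pderD w D1 (dug j i k))
             (pderD w (dS i j k) (dug i j k)).
rewrite {1}/cov3 dC.
exact: (@pcov_pcubic _ _ gx tx Sx (fun l a => LC l w a x)
  (fun a => pder w (dfun u a) x) (pder w (S i j k) x) (fun a b => pder w (g a b) x)
  i j k (LC_metric oU gC gU Ux w)).
Qed.

Lemma ricci_of_cubic (Gam : 'I_n -> 'I_n -> 'I_n -> 'rV[R]_n -> R) :
  (forall a b c, pderivable (Gam a b c) x) ->
  (forall y, U y -> forall i j k,
     \sum_l g l k y * (Gam l i j y - LC l i j y) = cubic_field i j k y) ->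
  (forall w i j k, DS w i j k = DS w j i k) ->
  (forall w i j k, DS w i j k = DS w i k j) ->
  (forall w k, mtrace hx (fun i j => DS w i j k) = 0) ->
  forall j k, ricci Gam j k x = pricci gx hx tx Sx DS Hx Rc j k.
Proof.
move=> dGam CE DS12 DS23 DS_tr j k.
have CE' y (Uy : U y) a b c :
    cubic_field a b c y = \sum_l g l c y * (Gam l a b y - LC l a b y).
  by rewrite CE.
rewrite /ricci -(mtrace_lower gxC hgx (fun i l => riem Gam l k i j x)).
rewrite (eq_mtrace hx (fun i m =>
  riem_change oU g_smooth gC gU m k i j Ux dGam CE')).
rewrite mtraceD (mtrace_lower gxC hgx (fun i l => riem LC l k i j x)) /pricci; congr (_ + _).
have HC a b : Hx a b = Hx b a by exact: hessC.
rewrite -(mtrace_curv_pcubic gxC hxC hgx tx Sx12 Sx23 Sx_tr DS12 DS23 DS_tr HC).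
have q a b c m : \sum_l (Gam l a b x - LC l a b x) * cubic_field c l m x =
    mtrace hx (fun l p => pcubic gx tx Sx a b p * pcubic gx tx Sx c l m).
  apply: eq_bigr => l _; rewrite -(raise_lower gxC hgx (fun l => Gam l a b x - LC l a b x) l).
  rewrite mulr_suml; apply: eq_bigr => p _; rewrite -CE' //.
  by rewrite -mulrA.
apply: eq_mtrace => i m; rewrite !cov3_pcubic !q //.
Qed.

Lemma contr2E i j : contr2 S (grad g u) i j x = pcontr2 hx tx Sx i j.
Proof.
rewrite /contr2 /grad (sum_mtraceE hx (fun k => S i j k x) (fun l => pder l u x)).
by rewrite -(mtrace_swap hxC).
Qed.

Lemma dt_hatE i j : \sum_k dfun u k x * hat3 g S k i j x = pcontr2 hx tx Sx i j.
Proof.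
rewrite /hat3 (sum_mtraceE hx (fun k => dfun u k x) (fun l => S i j l x)).
by apply: eq_mtrace => l p; rewrite mulrC.
Qed.

Lemma scrSE i j : scrS g S i j x = pscrS hx Sx i j.
Proof. exact: (pscrS_hat hx Sx12). Qed.

Lemma norm2SE : norm2S g S x = mtrace hx (pscrS hx Sx).
Proof. by apply: eq_mtrace => i j; exact: scrSE. Qed.

Lemma norm2_gradE : norm2_grad g u x = pnorm2 hx tx.
Proof. by do 2![apply: eq_bigr => ? _]; rewrite mulrA. Qed.

Section Connection.
Variable Gam : 'I_n -> 'I_n -> 'I_n -> 'rV[R]_n -> R.
Hypothesis dGam : forall a b c, pderivable (Gam a b c) x.
Hypothesis GamE : forall y, U y -> forall i j k,
     \sum_l g l k y * (Gam l i j y - LC l i j y) = cubic_field i j k y.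

(** The prescribed derivative of S is a trace-free symmetric projection, hence DS
is symmetric and trace-free without differentiating the inverse metric. *)
Lemma ricci_flat_ge3 : (3 <= n)%N ->
  hess_eq_ge3 g S u x -> cov_eq_ge3 g S u x ->
  (forall j k, ricci Gam j k x = 0) <->
  (forall i j, tracefree g (schouten g) i j x = 8^-1 * tau_ge3 g S u i j x) /\
  Scal g x = 9^-1 * (norm2S g S x - (n%:R - 1) * (n%:R + 2) * norm2_grad g u x).
Proof.
move=> n3 hE cE.
pose B j k := 4 / (n%:R - 2) * pscrS hx Sx j k - 3 * pcontr2 hx tx Sx j k.
have sE : (fun i j => scrS g S i j x) = pscrS hx Sx.
  by apply/funext => i; apply/funext => j; exact: scrSE.
have DSE w i j k : DS w i j k =
    3^-1 * psym30 gx hx (fun a b c => pS1 gx hx tx Sx B a b c w) i j k.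
  rewrite /DS cE; congr (_ * _).
  rewrite -[LHS]/(psym30 gx hx (fun a b c => S1_ge3 g S u a b c w x) i j k).
  apply: eq_psym30 => a b c.
  rewrite /S1_ge3 /pS1 /B -scrSE contr2E; congr (_ + _ + _ + _).
  exact: (sum_mtraceE hx (fun l => S a l w x) (fun m => S b c m x)).
have DS12 w i j k : DS w i j k = DS w j i k by rewrite !DSE psym30_12.
have DS23 w i j k : DS w i j k = DS w i k j by rewrite !DSE psym30_23.
have DS_tr w k : mtrace hx (fun i j => DS w i j k) = 0.
  by rewrite (eq_mtrace hx (fun i j => DSE w i j k)) mtraceZ mtrace_psym30 // mulr0.
have HE i j : Hx i j = 3 * schouten g i j x
  + 3^-1 * (tx i * tx j - 2^-1 * pnorm2 hx tx * gx i j)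
  + (3 * (n%:R - 2))^-1 * (pscrS hx Sx i j +
    (n%:R - 6) * mtrace hx (pscrS hx Sx) / (2 * (n%:R - 1) * (n%:R + 2)) * gx i j).
  by rewrite /Hx hE norm2_gradE norm2SE -scrSE.
have := pricci_eq0_ge3 gxC hxC hgx Sx12 Sx23 Sx_tr n3 HE DSE.
have tauE i j : tau_ge3 g S u i j x =
  2 / (3 * (n%:R - 2)) * ptracefree gx hx (pscrS hx Sx) i j
  - 2 / 3 * ptracefree gx hx (fun a b => pcontr2 hx tx Sx a b + tx a * tx b) i j
  + 2 * ptracefree gx hx (fun a b => schouten g a b x) i j.
  rewrite -sE /tau_ge3; congr (_ - _ * _ + _).
  rewrite -[LHS]/(ptracefree gx hx (fun a b => \sum_k dfun u k x * hat3 g S k a b x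
     + dfun u a x * dfun u b x) i j).
  by apply: eq_ptracefree => a b; rewrite dt_hatE.
rewrite -norm2_gradE -norm2SE => C; apply: iff_trans (iff_trans C _).
  split=> R0 j k; have := R0 j k; rewrite ricci_of_cubic //.
split=> -[PE ScE]; split=> // i j; have := PE i j; rewrite tauE //.
Qed.

Lemma ricci_flat_2 : n = 2%N ->
  tau2_tracefree g S u x -> cov_eq_2 g S u x ->
  (forall j k, ricci Gam j k x = 0) <->
  Scal g x = 9^-1 * (norm2S g S x - 4 * norm2_grad g u x) /\
  (forall i j, tau2 g S u i j x = 2 / 3 * E2 g S u i j x
     - 8 / 9 * (contr2 S (grad g u) i j x + dtdt u i j x
                - 2^-1 * norm2_grad g u x * g i j x)).
Proof.
move=> n2 tau0 cE.
have DSE w i j k : DS w i j k = psym30 gx hx (fun a b c =>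
    - (2 / 3) * (S a b c x * dfun u w x) + 2 * (dfun u a x * S b c w x)
    + E2 g S u a b x * g c w x) i j k by rewrite /DS cE.
have DS12 w i j k : DS w i j k = DS w j i k by rewrite !DSE psym30_12.
have DS23 w i j k : DS w i j k = DS w i k j by rewrite !DSE psym30_23.
have DS_tr w k : mtrace hx (fun i j => DS w i j k) = 0.
  by rewrite (eq_mtrace hx (fun i j => DSE w i j k)) mtrace_psym30.
have EE i j : E2 g S u i j x = pdivS hx DS i j + 2 / 3 * pcontr2 hx tx Sx i j.
  by rewrite /E2 contr2E.
have tauE i j : tau2 g S u i j x = 2 / 3 * Hx i j - 2 / 3 * pcontr2 hx tx Sx i j
  + 3^-1 * (pdivS hx DS i j + 2 / 3 * pcontr2 hx tx Sx i j)
  - 8 / 9 * (tx i * tx j - 2^-1 * pnorm2 hx tx * gx i j)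
  - 9^-1 * mtrace hx (pscrS hx Sx) * gx i j - 2^-1 * mtrace hx Rc * gx i j.
  by rewrite /tau2 EE contr2E norm2_gradE norm2SE.
have s_tf := pscrS_surface n2 gxC hxC hgx Sx12 Sx23 Sx_tr.
pose Rl m k i j := \sum_l g l m x * riem LC l k i j x.
have RcE j k : Rc j k = mtrace hx (fun i m => Rl m k i j).
  by rewrite (mtrace_lower gxC hgx (fun i l => riem LC l k i j x)).
have Rc_tf i j : Rc i j = 2^-1 * mtrace hx Rc * gx i j.
  rewrite (eq_mtrace hx RcE) RcE.
  apply: (ricci_surface n2 gxC hxC hgx (Rl := Rl)) => [m k a b|m k a b].
    exact: (riem_LC_antisym oU g_smooth gC gU).
  by rewrite /Rl -sumrN; apply: eq_bigr => l _; rewrite -mulrN riem_swap.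
have trdiv : mtrace hx (pdivS hx DS) = 0 by exact: mtrace_pdivS.
have tr_tau : mtrace hx (fun i j => tau2 g S u i j x) = 0 by exact: tau0.
rewrite (eq_mtrace hx tauE) in tr_tau.
have C := pricci_eq0_2 gxC hgx Sx_tr n2 s_tf Rc_tf trdiv tr_tau.
rewrite -norm2_gradE -norm2SE in C; apply: iff_trans (iff_trans C _).
  split=> R0 j k; have := R0 j k; rewrite ricci_of_cubic //.
split=> -[ScE PE]; split=> // i j; have := PE i j; rewrite tauE EE contr2E norm2_gradE norm2SE //.
Qed.

End Connection.
End AtPoint.
End ChartRicci.

(** * The Gauss equation *)

Section Pairing.
Context {R : realType} {m : nat}.

(** Linear forms reduce the calculus of R^m-valued maps to that of scalar
functions; a vector is zero once all of them vanish on it. *)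
Definition pairing (w : 'cV[R]_m) (v : 'rV[R]_m) : R := (v *m w) 0 0.

Fact pairing_is_linear w : linear (pairing w).
Proof. by move=> a u v; rewrite /pairing mulmxDl -scalemxAl !mxE. Qed.

HB.instance Definition _ w :=
  GRing.isLinear.Build R 'rV[R]_m R _ (pairing w) (pairing_is_linear w).

Lemma pairing_continuous w : continuous (pairing w).
Proof.
move=> v; rewrite /pairing.
have -> : (fun v : 'rV[R]_m => (v *m w) 0 0)
    = \sum_c (fun v : 'rV[R]_m => v 0 c * w c 0 : R).
  by apply/funext => u; rewrite mxE fct_sumE.
apply: differentiable_continuous; apply: differentiable_sum => c.
by apply: differentiableM; [exact: differentiable_coord|exact: differentiable_cst].
Qed.

Lemma pairing_eq0 v : (forall w, pairing w v = 0) -> v = 0.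
Proof.
move=> v0; apply/rowP => c; have := v0 (delta_mx c 0).
rewrite /pairing mxE (bigD1 c) //= big1 => [|b /negbTE bc].
  by rewrite mxE !eqxx mulr1 addr0 mxE.
by rewrite mxE bc mulr0.
Qed.

Context {n : nat}.
Implicit Types (U : set 'rV[R]_n) (F : 'rV[R]_n -> 'rV[R]_m).

Lemma pder_pairing w F i x : differentiable F x ->
  pder i (pairing w \o F) x = pairing w (pder i F x).
Proof.
move=> dF; have dL : differentiable (pairing w) (F x).
  by apply: linear_differentiable; exact: pairing_continuous.
rewrite /pder deriveE; last exact: differentiable_comp.
rewrite diff_comp //= diff_lin; last exact: pairing_continuous.
by rewrite deriveE.
Qed.

Lemma smooth_pairing w U F : open U -> smooth_on U F ->
  smooth_on U (pairing w \o F).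
Proof.
by move=> oU sF k; apply: Ck_on_linear => //; exact: pairing_continuous.
Qed.

End Pairing.

Section Gauss.
Context {R : realType} {n : nat}.
Variables (U : set 'rV[R]_n) (oU : open U).
Variables (Gam : 'I_n -> 'I_n -> 'I_n -> 'rV[R]_n -> R).
Variables (g : 'I_n -> 'I_n -> 'rV[R]_n -> R).
Variables (x : 'rV[R]_n) (Ux : U x).
Hypothesis dGam : forall a b c, pderivable (Gam a b c) x.
Hypothesis dg : forall a b, pderivable (g a b) x.

(** The Gauss and Codazzi equations combined, for one linear form applied to f
(phi) and xi (psi): the difference d_i d_j d_k phi - d_j d_i d_k phi = 0,
expanded in the frame. *)
Lemma gauss_scalar (B : 'I_n -> 'I_n -> R) (phi psi : 'rV[R]_n -> R) i j k :
  smooth_on U phi -> pderivable psi x ->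
  (forall y, U y -> forall i j, pder i (pder j phi) y =
     \sum_l Gam l i j y * pder l phi y + g i j y * psi y) ->
  (forall i, pder i psi x = \sum_l B i l * pder l phi x) ->
  \sum_l (riem Gam l k i j x + g j k x * B i l - g i k x * B j l) * pder l phi x
  + (pder i (g j k) x + \sum_p Gam p j k x * g i p x
     - (pder j (g i k) x + \sum_p Gam p i k x * g j p x)) * psi x = 0.
Proof.
move=> sphi dpsi E2 E1.
have dphi l : pderivable (pder l phi) x.
  apply: differentiable_pderivable; apply: smooth_on_differentiable Ux.
  exact: smooth_on_pder.
have D3 a b : pder a (pder b (pder k phi)) x =
    \sum_l (pder a (Gam l b k) x + \sum_p Gam l a p x * Gam p b k x
            + g b k x * B a l) * pder l phi x
    + (pder a (g b k) x + \sum_p Gam p b k x * g a p x) * psi x.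
  rewrite (pder_eq_on a oU Ux (fun y Uy => E2 y Uy b k)).
  have dP l : pderivable (fun y => Gam l b k y * pder l phi y) x.
    exact: (pderivableM (@dGam l b k) (@dphi l)).
  rewrite (pderD a (pderivable_sum dP) (pderivableM (@dg b k) dpsi)).
  rewrite (pder_sum a dP) (pderM a (@dg b k) dpsi) E1.
  have -> : \sum_l pder a (fun y => Gam l b k y * pder l phi y) x =
      \sum_l (pder a (Gam l b k) x + \sum_p Gam l a p x * Gam p b k x) * pder l phi x
      + (\sum_p Gam p b k x * g a p x) * psi x.
    under eq_bigr => l _ do
      rewrite (pderM a (@dGam l b k) (@dphi l)) (E2 _ Ux) mulrDr mulrA.
    rewrite !big_split /= mulr_suml addrA; congr (_ + _).
    under [RHS]eq_bigr => l _ do rewrite mulrDl mulr_suml.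
    rewrite big_split; congr (_ + _).
    under eq_bigr => l _ do rewrite mulr_sumr.
    rewrite exchange_big; apply: eq_bigr => l _; apply: eq_bigr => p _ /=; ring.
  have -> : \sum_l (pder a (Gam l b k) x + \sum_p Gam l a p x * Gam p b k x
            + g b k x * B a l) * pder l phi x =
    \sum_l (pder a (Gam l b k) x + \sum_p Gam l a p x * Gam p b k x) * pder l phi x
    + g b k x * \sum_l B a l * pder l phi x.
    rewrite mulr_sumr -big_split; apply: eq_bigr => l _ /=; ring.
  by ring.
have := pderC i j oU Ux (smooth_on_pder k sphi); rewrite !D3.
set p := (X in _ + X * _); set q := (X in _ = _ + X * _) => E.
have -> : \sum_l (riem Gam l k i j x + g j k x * B i l - g i k x * B j l) * pder l phi x
  = \sum_l (pder i (Gam l j k) x + \sum_p Gam l i p x * Gam p j k x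
            + g j k x * B i l) * pder l phi x
  - \sum_l (pder j (Gam l i k) x + \sum_p Gam l j p x * Gam p i k x
            + g i k x * B j l) * pder l phi x.
  rewrite -sumrB; apply: eq_bigr => l _; rewrite -mulrBl; congr (_ * _).
  rewrite /riem sumrB; ring.
rewrite mulrBl addrACA E -opprD subrr //.
Qed.

Context {m : nat}.
Variables (f xi : 'rV[R]_n -> 'rV[R]_m).
Hypothesis sf : smooth_on U f.
Hypothesis sxi : smooth_on U xi.
Hypothesis indep : forall (c : 'I_n -> R) d,
  \sum_l c l *: pder l f x + d *: xi x = 0 -> forall l, c l = 0.

(** The frame being independent, the tangential coefficients vanish
separately. *)
Lemma gauss (B : 'I_n -> 'I_n -> R) :
  (forall y, U y -> forall i j, pder i (pder j f) y =
     \sum_l Gam l i j y *: pder l f y + g i j y *: xi y) ->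
  (forall i, pder i xi x = \sum_l B i l *: pder l f x) ->
  forall l k i j, riem Gam l k i j x = g i k x * B j l - g j k x * B i l.
Proof.
move=> E2 E1 l k i j.
have df y : U y -> differentiable f y by exact: smooth_on_differentiable.
suff : riem Gam l k i j x + g j k x * B i l - g i k x * B j l = 0.
  by move/eqP; rewrite subr_eq0 => /eqP <-; rewrite addrK.
move: l; apply: (indep (d := pder i (g j k) x + \sum_p Gam p j k x * g i p x
     - (pder j (g i k) x + \sum_p Gam p i k x * g j p x))).
apply: pairing_eq0 => w.
have P y (Uy : U y) a : pder a (pairing w \o f) y = pairing w (pder a f y).
  by rewrite pder_pairing //; exact: df.
rewrite linearD linear_sum linearZ /=.
rewrite -[RHS](@gauss_scalar B (pairing w \o f) (pairing w \o xi) i j k).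
- congr (_ + _); apply: eq_bigr => l _; by rewrite linearZ P.
- exact: smooth_pairing.
- apply: differentiable_pderivable; apply: smooth_on_differentiable Ux.
  exact: smooth_pairing.
- move=> y Uy a b; rewrite (pder_eq_on a oU Uy (fun z Uz => P z Uz b)).
  rewrite (@pder_pairing _ _ _ w (pder b f)); last first.
    by apply: smooth_on_differentiable Uy; exact: smooth_on_pder.
  rewrite E2 // linearD linear_sum linearZ; congr (_ + _).
  by apply: eq_bigr => l _; rewrite linearZ P.
- move=> a; rewrite pder_pairing; last exact: smooth_on_differentiable Ux.
  rewrite E1 linear_sum; apply: eq_bigr => l _; by rewrite linearZ P.
Qed.

End Gauss.

Section ShapeOperator.
Context {R : realFieldType} {n : nat}.
Variables (g h : 'I_n -> 'I_n -> R).
Hypothesis gC : forall i j, g i j = g j i.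
Hypothesis hC : forall i j, h i j = h j i.
Hypothesis hg : forall i j, \sum_l h i l * g l j = (i == j)%:R.

(** The hypothesis is the Ricci contraction of the Gauss equation.  It says
B = (tr B) id, whose trace reads tr B = n tr B. *)
Lemma shape_eq0 (B : 'I_n -> 'I_n -> R) : (2 <= n)%N ->
  (forall j k, \sum_i (g i k * B j i - g j k * B i i) = 0) ->
  forall i l, B i l = 0.
Proof.
move=> n2 R0.
pose tB := \sum_i B i i.
have E j k : \sum_i g i k * B j i = g j k * tB.
  by apply/subr0_eq; rewrite -[RHS](R0 j k) sumrB mulr_sumr.
have BE j l : B j l = (j == l)%:R * tB.
  rewrite -(raise_lower gC hg (B j)); under eq_bigr => k _ do rewrite E mulrA (gC j).
  by rewrite -mulr_suml hg eq_sym.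
have tB0 : tB = 0.
  have : tB = n%:R * tB.
    rewrite {1}/tB; under eq_bigr => i _ do rewrite BE eqxx mul1r.
    by rewrite sumr_const card_ord mulr_natl.
  move/eqP; rewrite -subr_eq0 -{1}[tB]mul1r -mulrBl mulf_eq0 subr_eq0 eq_sym.
  by rewrite pnatr_eq1; case/orP => [/eqP n1|/eqP //]; rewrite n1 in n2.
by move=> i l; rewrite BE tB0 mulr0.
Qed.

End ShapeOperator.

(** * Relative and graph normalisations *)

Lemma col_mx_unit (R : fieldType) n (J : 'M[R]_(n, n + 1)) (v : 'rV[R]_(n + 1)) :
  row_free J -> ~~ (v <= J)%MS -> col_mx J v \in unitmx.
Proof.
move=> fJ nv; rewrite -row_free_unit; apply: inj_row_free => w.
rewrite -[w]hsubmxK mul_row_col [rsubmx w]mx11_scalar mul_scalar_mx.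
set d := rsubmx w 0 0; case: (eqVneq d 0) => [d0|dn0] E.
  have : lsubmx w *m J = 0 by rewrite -E d0 scale0r addr0.
  rewrite -[0 in RHS](mul0mx _ J) => /(row_free_inj fJ) ->.
  by rewrite d0 raddf0 row_mx0.
case/negP: nv; have -> : v = - (d^-1 *: lsubmx w) *m J.
  apply: (scalerI dn0); rewrite mulNmx -scalemxAl scalerN scalerA divff // scale1r.
  by apply/eqP; rewrite -addr_eq0 addrC; apply/eqP.
exact: submxMl.
Qed.

Section LocallyConstant.
Context {R : realType} {n : nat}.

(** Balls are convex: the mean value theorem applies on the segment joining a
point to the centre. *)
Lemma constant_on_ball m (F : 'rV[R]_n -> 'rV[R]_m) (x : 'rV[R]_n) e :
  (forall y, ball x e y -> differentiable F y /\ forall i, pder i F y = 0) ->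
  forall y, ball x e y -> F y = F x.
Proof.
move=> dF y xy; apply/subr0_eq/pairing_eq0 => w.
pose phi := pairing w \o F.
have dphi z : ball x e z -> differentiable phi z.
  move=> xz; apply: differentiable_comp; first exact: (dF z xz).1.
  apply: linear_differentiable; exact: pairing_continuous.
have D0 z : ball x e z -> 'D_(y - x) phi z = 0.
  move=> xz; rewrite deriveE; last exact: dphi.
  rewrite [y - x]row_sum_delta linear_sum big1 // => i _.
  rewrite linearZ /= -deriveE; last exact: dphi.
  have := @pder_pairing _ _ _ w F i z (dF z xz).1; rewrite /pder => ->.
  by rewrite -/(pder i F z) (dF z xz).2 linear0 scaler0.
have seg (s : R) : 0 <= s <= 1 -> ball x e (s *: (y - x) + x).
  move=> /andP[s0 s1]; move: xy; rewrite -!ball_normE /= => xy.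
  rewrite opprD addrCA subrr addr0 normrN normrZ ger0_norm //.
  by rewrite (le_lt_trans _ xy) // distrC -[leRHS]mul1r ler_wpM2r.
pose h (s : R) := phi (s *: (y - x) + x).
have dh (s : R) : 0 <= s <= 1 -> is_derive s 1 h 0.
  move=> s01; rewrite -[0](D0 _ (seg s s01)); apply: is_derive_line.
  by apply: diff_derivable; exact: dphi (seg s s01).
have [c c01] : exists2 c : R, c \in `]0, 1[%R & h 1 - h 0 = 0 * (1 - 0).
  apply: (@MVT _ h (fun=> 0)) => //.
    by move=> s; rewrite in_itv /= => /andP[? ?]; apply: dh; rewrite !ltW.
  apply: derivable_within_continuous => s; rewrite in_itv /= => s01.
  by case: (dh s s01).
by rewrite mul0r /h scale1r scale0r add0r subrK /phi /= linearB.
Qed.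

Lemma locally_constant (T : topologicalType) (V : Type) (F : T -> V) :
  connected [set: T] -> (forall p, \forall q \near p, F q = F p) ->
  forall p q, F q = F p.
Proof.
move=> cT lF p q; suff : [set q | F q = F p] q by [].
suff -> : [set q | F q = F p] = setT by [].
apply: cT; first by exists p.
- exists [set q | F q = F p]; last by rewrite setTI.
  rewrite openE => r /= rp; rewrite /interior; apply: filterS (lF r) => s.
  by rewrite rp.
- exists [set q | F q = F p]; last by rewrite setTI.
  rewrite -openC openE => r /= rp; rewrite /interior.
  by apply: filterS (lF r) => s /= ->.
Qed.

End LocallyConstant.

Lemma row_jacobian (R : realType) n m (F : 'rV[R]_n -> 'rV[R]_m) x k :
  differentiable F x -> row k (jacobian F x) = pder k F x.
Proof. by move=> dF; rewrite /pder deriveEjacobian // rowE. Qed.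

Section Chart.
Context {R : realType} {n : nat} (M : manifold R n).
Variables (f xi : M -> 'rV[R]_(n + 1)) (a : atlas_index M).

Let U := chart_image a.
Let fa := in_chart a f.
Let xa := in_chart a xi.
Hypothesis nrm : is_normalisation f xi.

Lemma chart_image_open : open U. Proof. exact: cimg_open. Qed.
Let oU := chart_image_open.

Let sf : smooth_on U fa. Proof. by case: nrm => + _ _; exact. Qed.
Let sxi : smooth_on U xa. Proof. by case: nrm => _ + _; exact. Qed.
Let df x : U x -> differentiable fa x. Proof. exact: smooth_on_differentiable. Qed.

Lemma frame_unit x : U x -> frame f xi a x \in unitmx.
Proof. by case: nrm => _ _ + Ux => /(_ a x Ux)[? ?]; exact: col_mx_unit. Qed.

Lemma mul_frame x (c : 'rV[R]_(n + 1)) : U x -> c *m frame f xi a x =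
  \sum_k c 0 (lshift 1 k) *: pder k fa x + c 0 (rshift n 0) *: xa x.
Proof.
move=> Ux; rewrite /frame -{1}[c]hsubmxK mul_row_col; congr (_ + _).
  rewrite mulmx_sum_row; apply: eq_bigr => k _.
  by rewrite row_jacobian ?mxE //; exact: df.
by rewrite [rsubmx c]mx11_scalar mul_scalar_mx mxE.
Qed.

(** The Gauss-Weingarten decomposition of a vector. *)
Lemma frame_decomp x v : U x -> v =
  \sum_k frame_coord f xi a x v 0 (lshift 1 k) *: pder k fa x
  + frame_coord f xi a x v 0 (rshift n 0) *: xa x.
Proof. by move=> Ux; rewrite -mul_frame // mulmxKV // frame_unit. Qed.

Lemma frame_indep x (c : 'I_n -> R) d : U x ->
  \sum_l c l *: pder l fa x + d *: xa x = 0 -> forall l, c l = 0.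
Proof.
move=> Ux E l; pose v : 'rV[R]_(n + 1) := row_mx (\row_l c l) (\row__ d).
have : v *m frame f xi a x = 0.
  rewrite mul_frame // -[RHS]E; congr (_ + _).
    by apply: eq_bigr => k _; rewrite row_mxEl mxE.
  by rewrite row_mxEr mxE.
move/(canRL (mulmxK (frame_unit Ux))); rewrite mul0mx => /rowP/(_ (lshift 1 l)).
by rewrite row_mxEl !mxE.
Qed.

Lemma pderivable_frame x i j : U x -> pderivable (fun y => frame f xi a y i j) x.
Proof.
move=> Ux.
have P (F : 'rV[R]_n -> 'rV[R]_(n + 1)) : smooth_on U F -> pderivable (fun y => F y 0 j : R) x.
  move=> sF; apply: (@pderivable_coord R n (n + 1) F).
  by apply: differentiable_pderivable; exact: smooth_on_differentiable Ux.
rewrite /frame; case: (split_ordP i) => k ->.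
  apply: (@pderivable_eq_on _ _ _ U (fun y => pder k fa y 0 j)) => //.
    by move=> y Uy; rewrite col_mxEu -row_jacobian ?mxE //; exact: df.
  by apply: (P (pder k fa)); exact: smooth_on_pder.
apply: (@pderivable_eq_on _ _ _ U (fun y => xa y 0 j)) => //; last exact: P.
by move=> y _; rewrite col_mxEd (ord1 k).
Qed.

Lemma pderivable_induced x k i j : U x -> pderivable (induced_conn f xi a k i j) x.
Proof.
move=> Ux; rewrite /induced_conn /frame_coord; under eq_fun do rewrite mxE.
apply: pderivable_sum => c; apply: pderivableM.
  apply: (@pderivable_coord R n (n + 1) (pder i (pder j fa))).
  apply: differentiable_pderivable; apply: smooth_on_differentiable Ux.
  by do 2!apply: smooth_on_pder.
apply: (@pderivable_invmx _ _ _ _ U) => //; first exact: frame_unit.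
by move=> ? ?; exact: pderivable_frame.
Qed.

Section Relative.
Hypothesis rel : relative_normalisation f xi.

Lemma weingarten x i : U x -> pder i xa x =
  \sum_l frame_coord f xi a x (pder i xa x) 0 (lshift 1 l) *: pder l fa x.
Proof.
case: rel => _ _ th Ux; rewrite {1}(frame_decomp (pder i xa x) Ux).
by have := th a x Ux i; rewrite /Theta => ->; rewrite scale0r addr0.
Qed.

Lemma gauss_decomp x i j : U x -> pder i (pder j fa) x =
  \sum_l induced_conn f xi a l i j x *: pder l fa x
  + assoc_metric f xi a i j x *: xa x.
Proof. by move=> Ux; rewrite {1}(frame_decomp (pder i (pder j fa) x) Ux). Qed.

Variable g : 'I_n -> 'I_n -> 'rV[R]_n -> R.
Hypothesis gE : forall x, U x -> forall i j, assoc_metric f xi a i j x = g i j x.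
Hypothesis g_smooth : forall i j, smooth_on U (g i j).
Hypothesis gC : forall x, U x -> forall i j, g i j x = g j i x.
Hypothesis gU : forall x, U x -> metric_mx g x \in unitmx.

(** The shape operator B is recovered from the Ricci tensor of the induced
connection by the contracted Gauss equation. *)
Lemma normal_constant_ricci x : (2 <= n)%N -> U x ->
  (forall i, pder i xa x = 0) <->
  (forall j k, ricci (induced_conn f xi a) j k x = 0).
Proof.
move=> n2 Ux.
pose B i l := frame_coord f xi a x (pder i xa x) 0 (lshift 1 l).
have dG k i j : pderivable (induced_conn f xi a k i j) x.
  exact: pderivable_induced.
have dg i j : pderivable (g i j) x by exact: (pderivable_g g_smooth).
have RE j k : ricci (induced_conn f xi a) j k x =
    \sum_i (g i k x * B j i - g j k x * B i i).
  apply: eq_bigr => i _.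
  apply: (gauss oU Ux dG dg sf sxi (fun c d => @frame_indep x c d Ux)) => //.
    by move=> y Uy i' j'; rewrite gauss_decomp // gE.
  by move=> i'; exact: weingarten.
split=> [D0 j k|R0 i].
  rewrite RE big1 // => i _.
  have B0 i' l : B i' l = 0 by rewrite /B D0 /frame_coord mul0mx mxE.
  by rewrite !B0 !mulr0 subrr.
have B0 := @shape_eq0 _ _ (fun i j => g i j x) (fun i j => ginv g i j x)
  (gC Ux) (ginv_mul gU Ux) B n2 (fun j k => etrans (esym (RE j k)) (R0 j k)).
rewrite weingarten // big1 // => l _.
by rewrite -/(B i l) B0 scale0r.
Qed.

Lemma LC_assoc_metric x k i j : U x ->
  levi_civita (assoc_metric f xi a) k i j x = levi_civita g k i j x.
Proof.
move=> Ux; rewrite /levi_civita; congr (_ * _); apply: eq_bigr => l _.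
have dE c b d : pder c (assoc_metric f xi a b d) x = pder c (g b d) x.
  by apply: (pder_eq_on _ oU Ux) => y Uy; exact: gE.
rewrite !dE; congr (_ * _); rewrite /ginv; congr (invmx _ _ _).
by apply/matrixP => b c; rewrite !mxE gE.
Qed.

End Relative.
End Chart.

Section Global.
Context {R : realType} {n : nat} (M : manifold R n).
Variables (f xi : M -> 'rV[R]_(n + 1)).
Hypothesis rel : relative_normalisation f xi.

Let nrm : is_normalisation f xi. Proof. by case: rel. Qed.

Lemma normal_constant :
  (forall a x, chart_image a x -> forall i, pder i (in_chart a xi) x = 0) ->
  forall p q, xi q = xi p.
Proof.
move=> D0; apply: locally_constant; first exact: mfd_connected.
move=> p; have [a ap] := atlas_cover p.
have Up : chart_image a (cmap (atlas a) p) by exists p.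
have [e /= e0 eU] := (nbhs_ballP _ _).1 (open_nbhs_nbhs (conj (@chart_image_open _ _ _ a) Up)).
have xiK q : cdom (atlas a) q -> xi q = in_chart a xi (cmap (atlas a) q).
  by move=> aq; rewrite /in_chart /= cmapK.
have near_dom : \forall q \near p, cdom (atlas a) q.
  by apply: open_nbhs_nbhs; split=> //; exact: cdom_open.
have near_ball : \forall q \near p, ball (cmap (atlas a) p) e (cmap (atlas a) q).
  have := cmap_continuous ap; apply.
  exact: nbhsx_ballx.
apply: filterS2 near_dom near_ball => q aq xq.
rewrite (xiK q aq) (xiK p ap); apply: constant_on_ball xq => y /eU Uy.
split; last by move=> i; exact: D0.
by apply: smooth_on_differentiable Uy; case: nrm => _ + _; exact.
Qed.

(** The graph function is F = w(f), with w a linear form equal to 1 on the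
constant value of xi; such a w exists because xi is transversal, hence non-zero.
On an empty manifold any w will do. *)
Lemma graph_normalisationP : graph_normalisation f xi <->
  forall a x, chart_image a x -> forall i, pder i (in_chart a xi) x = 0.
Proof.
split=> [[_ [F _ gF]] a x Ux i|D0]; first by case: (gF a x Ux).
split=> //; have cxi := normal_constant D0.
have [w w1] : exists w, forall p, pairing w (xi p) = 1.
  have [[p _]|noM] := pselect (exists p : M, True); last first.
    by exists 0 => p; case: noM; exists p.
  have [a ap] := atlas_cover p.
  have Up : chart_image a (cmap (atlas a) p) by exists p.
  have xip : xi p != 0.
    case: nrm => _ _ /(_ a _ Up)[_]; apply: contraNneq => xi0.
    by rewrite /in_chart /= cmapK // xi0 sub0mx.
  have [w wn0] : exists w, pairing w (xi p) != 0.
    apply: contrapT => nw; case/eqP: xip; apply: pairing_eq0 => w.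
    by apply: contrapT => /eqP wn; apply: nw; exists w.
  exists ((pairing w (xi p))^-1 *: w) => q.
  by rewrite (cxi p q) /pairing -scalemxAr mxE mulVf.
exists (pairing w \o f).
  move=> a; apply: (@smooth_pairing _ _ _ w _ (in_chart a f) (@chart_image_open _ _ _ a)).
  by case: nrm => + _ _; exact.
move=> a x Ux; split; last exact: D0.
move=> i j; have oU := @chart_image_open _ _ _ a.
have sf : smooth_on (chart_image a) (in_chart a f) by case: nrm => + _ _; exact.
have P k y (Uy : chart_image a y) :
    pder k (in_chart a (pairing w \o f)) y = pairing w (pder k (in_chart a f) y).
  exact: pder_pairing (smooth_on_differentiable sf Uy).
rewrite {1}(gauss_decomp nrm _ _ Ux); congr (_ + _ *: _).
rewrite /hess /cov1 /dfun (pder_eq_on i oU Ux (P j)).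
rewrite (@pder_pairing _ _ _ w (pder j (in_chart a f))); last first.
  by apply: smooth_on_differentiable Ux; exact: smooth_on_pder.
rewrite (gauss_decomp nrm _ _ Ux) linearD linear_sum linearZ /=.
rewrite [pairing w (in_chart a xi x)]w1 [_%:A]mulr1.
under [X in _ - X]eq_bigr => k _ do rewrite P //.
under eq_bigr => k _ do rewrite linearZ /=.
by rewrite addrAC subrr add0r.
Qed.

End Global.

Theorem theorem6 (R : realType) (n : nat) (n_ge2 : (2 <= n)%N)
    (M : manifold R n) (M_sc : simply_connected R M)
    (g : tfield2 M) (S : tfield3 M) (t : M -> R) (hab : abundant g S t)
    (f xi : M -> 'rV[R]_(n + 1)) (hass : associated_normalisation f xi g S t) :
  graph_normalisation f xi <->
  ((3 <= n)%N ->
     forall a x, chart_image a x ->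
       (forall i j, tracefree (g a) (schouten (g a)) i j x =
          8^-1 * tau_ge3 (g a) (S a) (in_chart a t) i j x) /\
       Scal (g a) x =
         9^-1 * (norm2S (g a) (S a) x
                 - (n%:R - 1) * (n%:R + 2) * norm2_grad (g a) (in_chart a t) x))
  /\
  (n = 2%N ->
     forall a x, chart_image a x ->
       Scal (g a) x =
         9^-1 * (norm2S (g a) (S a) x
                 - 4 * norm2_grad (g a) (in_chart a t) x) /\
       (forall i j, tau2 (g a) (S a) (in_chart a t) i j x =
          2 / 3 * E2 (g a) (S a) (in_chart a t) i j x
          - 8 / 9 * (contr2 (S a) (grad (g a) (in_chart a t)) i j x
                     + dtdt (in_chart a t) i j x
                     - 2^-1 * norm2_grad (g a) (in_chart a t) x * g a i j x))).
Proof.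
case: hass => rel ass; case: hab => gM SC tS ab3 ab2.
case: gM => -[gS _] gP; case: SC => -[SS _] SP.
have gC a x (Ux : chart_image a x) := (gP a x Ux).1.
have gU a x (Ux : chart_image a x) := (gP a x Ux).2.
have S12 a x (Ux : chart_image a x) : forall i j k, S a i j k x = S a j i k x.
  by case: (SP a x Ux).
have S23 a x (Ux : chart_image a x) : forall i j k, S a i j k x = S a i k j x.
  by case: (SP a x Ux).
have S_tr a x (Ux : chart_image a x) :
    forall k, trg (g a) (fun i j => S a i j k) x = 0 by case: (SP a x Ux).
have gE a x (Ux : chart_image a x) : forall i j, assoc_metric f xi a i j x = g a i j x.
  exact: (ass a x Ux).1.
have GamE a y (Uy : chart_image a y) i j k :
    \sum_l g a l k y * (induced_conn f xi a l i j y - levi_civita (g a) l i j y) =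
    3^-1 * (S a i j k y + dfun (in_chart a t) i y * g a j k y
     + dfun (in_chart a t) j y * g a i k y + dfun (in_chart a t) k y * g a i j y).
  rewrite -(ass a y Uy).2; apply: eq_bigr => l _.
  by rewrite gE // (LC_assoc_metric (gE a)).
have nrm : is_normalisation f xi by case: rel.
have dG a x (Ux : chart_image a x) b c d : pderivable (induced_conn f xi a b c d) x.
  exact: pderivable_induced.
have step a x (Ux : chart_image a x) := normal_constant_ricci nrm rel
  (gE a) (gS a) (gC a) (gU a) n_ge2 Ux.
have oU a : open (chart_image a) := @chart_image_open R n M a.
have R3 a x (Ux : chart_image a x) (n3 : (3 <= n)%N) :=
  let: And3 h c _ := (ab3 n3).2 a x Ux in
  ricci_flat_ge3 (oU a) (gS a) (gC a) (gU a) (SS a) (tS a) (S12 a) (S23 a) (S_tr a) Ux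
    (dG a x Ux) (GamE a) n3 h c.
have R2 a x (Ux : chart_image a x) (n2 : n = 2%N) :=
  let: And4 h c _ _ := ab2 n2 a x Ux in
  ricci_flat_2 (oU a) (gS a) (gC a) (gU a) (SS a) (tS a) (S12 a) (S23 a) (S_tr a) Ux
    (dG a x Ux) (GamE a) n2 h c.
apply: iff_trans (graph_normalisationP rel) _; split=> [D0|[C3 C2] a x Ux].
  by split=> nE a x Ux; [apply/(R3 a x Ux nE)|apply/(R2 a x Ux nE)];
    apply/(step a x Ux); exact: D0.
apply/(step a x Ux); move: n_ge2; rewrite leq_eqVlt => /orP[/eqP/esym n2|n3].
  by apply/(R2 a x Ux n2); exact: C2.
by apply/(R3 a x Ux n3); exact: C3.
Qed.
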